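(* Let $(\bm{X}_i)_{i\in\mathbb{N}}$ be an IID sequence with the same distribution as $\bm{X}$, and let the hypotheses $(\mathscr{H}_k)_{k\in[m]}$, losses $\ell_k$, risks $R_{k,n}$ and $r_k$, optimal index $k^*$, penalties $P_{k,n}$ and estimator $$\hat{K}_n=\min\,\underset{k\in[m]}{\arg\min}\left\{\min_{\bm{\theta}_k\in\mathbb{T}_k}R_{k,n}(\bm{\theta}_k)+P_{k,n}\right\}$$ be as defined in the context. Assume that for each $k\in[m]$: (A1) $\mathbb{T}_k$ is compact and there exists $\bm{\tau}_k\in\mathbb{T}_k$ such that $\mathrm{E}\{\ell_k(\bm{X};\bm{\tau}_k)^2\}<\infty$. (A2) There exists a measurable function $\mathfrak{C}_k:\mathbb{X}\to\mathbb{R}_{\ge 0}$ such that $\mathrm{E}\{\mathfrak{C}_k(\bm{X})^2\}<\infty$ and $|\ell_k(\bm{x};\bm{\theta}_k)-\ell_k(\bm{x};\bm{\tau}_k)|\le\mathfrak{C}_k(\bm{x})\|\bm{\theta}_k-\bm{\tau}_k\|$ for every $\bm{\theta}_k,\bm{\tau}_k\in\mathbb{T}_k$ and almost every $\bm{x}\in\mathbb{X}$. (B1) $P_{k,n}>0$ for each $n\in\mathbb{N}$, and $P_{k,n}=o_{\mathrm{Pr}}(1)$ as $n\to\infty$ (i.e. $P_{k,n}\to 0$ in probability). (B2$^*$) If $k<l$ (with $l\in[m]$), then $n\,\{P_{l,n}-P_{k,n}\}\to\infty$ in probability, as $n\to\infty$. (C1) $r_k$ is Lipschitz continuous on $\mathbb{T}_k$,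 and is uniquely minimised over $\mathbb{T}_k$, and twice differentiable, at some $\bm{\theta}_k^*\in\mathbb{T}_k$. (C2) For almost all $\bm{x}\in\mathbb{X}$, $\ell_k(\bm{x};\cdot)$ is Lipschitz continuous on $\mathbb{T}_k$ and differentiable at $\bm{\theta}_k^*$. (C3) The set $\mathbb{T}_k$ is second order regular at $\bm{\theta}_k^*$. (C4) The quadratic growth condition holds for $r_k$ (on $\mathbb{T}_k$) at $\bm{\theta}_k^*$. (C5) If $r_k(\bm{\theta}_k^* )=r_{k^*}(\bm{\theta}_{k^*}^* )$, then $n\left(R_{k,n}(\bm{\theta}_k^* )-R_{k^*,n}(\bm{\theta}_{k^*}^* )\right)=O_{\mathrm{Pr}}(1)$ (bounded in probability as $n\to\infty$). Then $$\lim_{n\to\infty}\mathrm{Pr}\left(\hat{K}_n=k^*\right)=1.$$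
   Context: Let $(\Omega,\mathcal{F},\mathrm{Pr})$ be a probability space with expectation $\mathrm{E}$, and let $\bm{X}:\Omega\to\mathbb{X}\subset\mathbb{R}^d$ be a random variable with law $\mathrm{Pr}_{\bm{X}}$ on $(\mathbb{X},\mathcal{B}(\mathbb{X}))$, where $\mathcal{B}(\mathbb{X})$ is the Borel $\sigma$-algebra; ''almost every/all $\bm{x}\in\mathbb{X}$'' is with respect to $\mathrm{Pr}_{\bm{X}}$. For $n\in\mathbb{N}$ write $[n]=\{1,\dots,n\}$. Fix $m\in\mathbb{N}$. For each $k\in[m]$, a hypothesis is a set of functions $$\mathscr{H}_k=\{h_k(\cdot;\bm{\theta}_k):\mathbb{X}\to\mathbb{R},\ \bm{\theta}_k\in\mathbb{T}_k\},\qquad \mathbb{T}_k\subset\mathbb{R}^{q_k},\ q_k\in\mathbb{N}.$$ Let $\ell:\mathbb{R}\to\mathbb{R}$ be a loss function and write $\ell_k(\bm{x};\bm{\theta}_k)=\ell(h_k(\bm{x};\bm{\theta}_k))$; the map $\ell_k(\cdot;\bm{\theta}_k):\mathbb{X}\to\mathbb{R}$ is measurable for each $\bm{\theta}_k\in\mathbb{T}_k$. The empirical and expected risks are $$R_{k,n}(\bm{\theta}_k)=\frac1n\sum_{i=1}^n\ell_k(\bm{X}_i;\bm{\theta}_k),\qquad r_k(\bm{\theta}_k)=\mathrm{E}\{\ell_k(\bm{X};\bm{\theta}_k)\}.$$ The optimal hypothesis index is $$k^*=\min\,\underset{k\in[m]}{\arg\min}\left\{\min_{\bm{\theta}_k\in\mathbb{T}_k}r_k(\bm{\theta}_k)\right\},$$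 i.e. the smallest index among those minimising $\min_{\bm{\theta}_k\in\mathbb{T}_k}r_k(\bm{\theta}_k)$ over $k\in[m]$. The penalties $P_{k,n}:\Omega\to\mathbb{R}_{\ge0}$ ($k\in[m]$, $n\in\mathbb{N}$) are random variables, which may depend on the data and the hypothesis index. A sequence of random variables $Z_n\to\infty$ in probability if for every $M>0$, $\mathrm{Pr}(Z_n>M)\to1$. At a point of $\mathbb{T}_k$ that is not interior, (twice) differentiability of a function on $\mathbb{T}_k$ is understood for an extension of the function to a neighbourhood of that point in $\mathbb{R}^{q_k}$. Second order regularity. Let $\mathbb{T}\subset\mathbb{R}^q$, and let $\mathrm{dist}(\bm{a},S)=\inf_{\bm{s}\in S}\|\bm{a}-\bm{s}\|$ (equal to $+\infty$ if $S=\emptyset$). The contingent cone $\mathcal{T}_{\mathbb{T}}(\bm{\theta})$ to $\mathbb{T}$ at $\bm{\theta}\in\mathbb{T}$ is the set of $\bm{\eta}\in\mathbb{R}^q$ for which there exist sequences $(\bm{\eta}_j)_{j\in\mathbb{N}}\subset\mathbb{R}^q$ and $(t_j)_{j\in\mathbb{N}}\subset(0,\infty)$ with $\bm{\eta}_j\to\bm{\eta}$, $t_j\to0$ and $\bm{\theta}+t_j\bm{\eta}_j\in\mathbb{T}$ for each $j$. The second order tangent set of $\mathbb{T}$ at $\bm{\theta}\in\mathbb{T}$ in the direction $\bm{\eta}\in\mathcal{T}_{\mathbb{T}}(\bm{\theta})$ is $$\mathcal{T}^2_{\mathbb{T}}(\bm{\theta},\bm{\eta})=\left\{\bm{\tau}\in\mathbb{R}^q:\mathrm{dist}\left(\bm{\theta}+t\bm{\eta}+\tfrac12t^2\bm{\tau},\mathbb{T}\right)=o(t^2),\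 t\ge0\right\},$$ with $o(t^2)$ as $t\downarrow0$. The set $\mathbb{T}$ is second order regular at $\bm{\theta}^*\in\mathbb{T}$ if for any sequence $(\bm{\theta}_j)_{j\in\mathbb{N}}\subset\mathbb{T}$ of the form $\bm{\theta}_j=\bm{\theta}^*+t_j\bm{\eta}+\tfrac12t_j^2\bm{\tau}_j$, where $(t_j)\subset(0,\infty)$, $(\bm{\tau}_j)\subset\mathbb{R}^q$, $t_j\to0$ and $t_j\bm{\tau}_j\to\bm{0}$, it follows that $\lim_{j\to\infty}\mathrm{dist}(\bm{\tau}_j,\mathcal{T}^2_{\mathbb{T}}(\bm{\theta}^*,\bm{\eta}))=0$. Quadratic growth. A function $r:\mathbb{T}\to\mathbb{R}$ satisfies the quadratic growth condition at $\bm{\theta}^*\in\mathbb{T}$ if there exist a constant $\mathfrak{C}>0$ and a neighbourhood $\mathcal{N}\subset\mathbb{R}^q$ of $\bm{\theta}^*$ such that $r(\bm{\theta})\ge r(\bm{\theta}^* )+\mathfrak{C}\|\bm{\theta}-\bm{\theta}^*\|^2$ for all $\bm{\theta}\in\mathcal{N}\cap\mathbb{T}$. *)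

(* Defs.v *)
From HB Require Import structures.
From mathcomp Require Export all_boot all_order all_algebra.
From mathcomp Require Export all_classical all_reals all_analysis.

Set Implicit Arguments.
Unset Strict Implicit.
Unset Printing Implicit Defensive.

Export Order.TTheory GRing.Theory Num.Theory.
Export numFieldNormedType.Exports.

#[global] Open Scope classical_set_scope.
#[global] Open Scope ring_scope.

(* The library norm on 'rV[R]_q is the sup norm; its topology is the usual one.
   Euclidean norms are used wherever a norm occurs in a formula.
   Library notions that do not depend on the choice of a norm (compactness,
   neighbourhoods, convergence, differentiability, Lipschitz continuity) are
   used as they are. *)
Definition enorm (R : realType) (q : nat) (v : 'rV[R]_q) : R :=
  Num.sqrt (\sum_(i < q) v ord0 i ^+ 2).

Section SecondOrderGeometry.
Context {R : realType} {q : nat}.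
Implicit Types (T : set 'rV[R]_q) (theta eta : 'rV[R]_q).

(* ereal_inf set0 = +oo *)
Definition dist (a : 'rV[R]_q) (S : set 'rV[R]_q) : \bar R :=
  ereal_inf [set (enorm (a - s))%:E | s in S].

Definition contingent_cone T theta : set 'rV[R]_q :=
  [set eta | exists (eta_ : nat -> 'rV[R]_q) (t_ : nat -> R),
     [/\ forall j, 0 < t_ j,
         eta_ j @[j --> \oo] --> eta,
         t_ j @[j --> \oo] --> (0 : R) &
         forall j, T (theta + t_ j *: eta_ j)]].

(* The o(t^2) condition, as t decreases to 0, is stated as convergence of the
   quotient by t^2. *)
Definition second_order_tangent_set T theta eta : set 'rV[R]_q :=
  [set tau |
    (dist (theta + t *: eta + (2^-1 * t ^+ 2) *: tau) T * ((t ^+ 2)^-1)%:E)%E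
      @[t --> (0 : R)^'+] --> 0%E].

(* The requirement that eta be in the contingent cone is implied by the others:
   theta_j = theta + t_j *: (eta + 2^-1 *: (t_j *: tau_j)). *)
Definition second_order_regular T theta : Prop :=
  forall eta (t_ : nat -> R) (tau_ : nat -> 'rV[R]_q),
    contingent_cone T theta eta ->
    (forall j, 0 < t_ j) ->
    t_ j @[j --> \oo] --> (0 : R) ->
    t_ j *: tau_ j @[j --> \oo] --> (0 : 'rV[R]_q) ->
    (forall j, T (theta + t_ j *: eta + (2^-1 * t_ j ^+ 2) *: tau_ j)) ->
    dist (tau_ j) (second_order_tangent_set T theta eta) @[j --> \oo] --> 0%E.

Definition quadratic_growth T (r : 'rV[R]_q -> R) theta : Prop :=
  exists2 C : R, 0 < C &
    \forall theta' \near theta, T theta' ->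
      r theta + C * enorm (theta' - theta) ^+ 2 <= r theta'.

(* Functions on T are represented by total functions whose values outside T are
   irrelevant.  At an interior point of T every extension g coincides with f
   near x, so this is then differentiability of f itself. *)
Definition differentiable_on T (f : 'rV[R]_q -> R) (x : 'rV[R]_q) : Prop :=
  exists2 g : 'rV[R]_q -> R, {in T, g =1 f} & differentiable g x.

Definition gradient (g : 'rV[R]_q -> R) (x : 'rV[R]_q) : 'rV[R]_q :=
  \row_(i < q) 'D_(delta_mx ord0 i) g x.

Definition twice_differentiable_on T (f : 'rV[R]_q -> R) (x : 'rV[R]_q) : Prop :=
  exists g : 'rV[R]_q -> R,
    [/\ {in T, g =1 f},
        \forall y \near x, differentiable g y &
        differentiable (gradient g) x].

Definition unique_minimiser T (f : 'rV[R]_q -> R) (x : 'rV[R]_q) : Prop :=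
  T x /\ forall y, T y -> y <> x -> f x < f y.

End SecondOrderGeometry.

Section Minima.
Context {R : realType}.

(* The minimum of S; a default value when S has no minimum. *)
Definition minimum (S : set R) : R := xget 0 (S `&` lbound S).

Definition argmin (m : nat) (f : 'I_m.+1 -> R) : set 'I_m.+1 :=
  [set k | forall j, f k <= f j].

(* The default value ord0 is never used: argmin f is not empty. *)
Definition min_argmin (m : nat) (f : 'I_m.+1 -> R) : 'I_m.+1 :=
  xget ord0 [set k | argmin f k /\ forall j, argmin f j -> (k <= j)%N].

End Minima.

(* The subset XX as a type, with the Borel sigma-algebra of its subspace
   topology.  The library requires measurable types to be pointed; the point x0
   plays no other role, and one exists as soon as there is an XX-valued random
   variable. *)
Definition pointed_subset (R : realType) (d : nat) (XX : set 'rV[R]_d)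
  (x0 : set_type XX) : Type := set_type XX.
HB.instance Definition _ (R : realType) (d : nat) (XX : set 'rV[R]_d)
  (x0 : set_type XX) := Topological.copy (pointed_subset x0) (set_type XX).
HB.instance Definition _ (R : realType) (d : nat) (XX : set 'rV[R]_d)
  (x0 : set_type XX) := isPointed.Build (pointed_subset x0) x0.

Notation borel_type x0 := (g_sigma_algebraType (@open (pointed_subset x0))).

Section Probability.
Context {R : realType} {dO : measure_display} {Omega : measurableType dO}.
Variable P : probability Omega R.

Definition mutually_independent (dT : measure_display)
    (T : measurableType dT) (X_ : nat -> {RV P >-> T}) : Prop :=
  forall (J : seq nat) (A : nat -> set T),
    uniq J -> (forall i, measurable (A i)) ->
    P (\bigcap_(i in [set` J]) (X_ i @^-1` A i)) =
    (\prod_(i <- J) P (X_ i @^-1` A i))%E.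

Definition same_distribution (dT : measure_display) (T : measurableType dT)
    (Y Z : {RV P >-> T}) : Prop :=
  forall A, measurable A -> distribution P Y A = distribution P Z A.

Definition finite_second_moment (Z : Omega -> R) : Prop :=
  ('E_P[fun w => (Z w ^+ 2)%R] < +oo)%E.

Definition cvg_in_prob (Z : nat -> Omega -> R) (c : R) : Prop :=
  forall e : R, 0 < e ->
    P [set w | e < `|Z n w - c|] @[n --> \oo] --> 0%E.

Definition diverges_in_prob (Z : nat -> Omega -> R) : Prop :=
  forall M : R, 0 < M -> P [set w | M < Z n w] @[n --> \oo] --> 1%E.

Definition bounded_in_prob (Z : nat -> Omega -> R) : Prop :=
  forall e : R, 0 < e -> exists2 M : R, 0 < M &
    \forall n \near \oo, (P [set w | (M < `|Z n w|)%R] <= e%:E)%E.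

End Probability.

Section Risks.
Context {R : realType} {dO : measure_display} {Omega : measurableType dO}.
Variable P : probability Omega R.
Context {dT : measure_display} {T : measurableType dT}.

(* The sample X_1, ..., X_n of size n is X_ 0, ..., X_ n.-1. *)
Definition emp_risk (q : nat) (lk : T -> 'rV[R]_q -> R)
    (X_ : nat -> Omega -> T) (n : nat) (theta : 'rV[R]_q) (w : Omega) : R :=
  n%:R^-1 * \sum_(i < n) lk (X_ i w) theta.

(* fine is harmless: the expectation is finite under the assumptions made. *)
Definition risk (q : nat) (lk : T -> 'rV[R]_q -> R) (X : Omega -> T)
    (theta : 'rV[R]_q) : R :=
  fine ('E_P[fun w => lk (X w) theta])%E.

Context {m : nat} {q : 'I_m.+1 -> nat}.
Variables (TT : forall k, set 'rV[R]_(q k)) (lk : forall k, T -> 'rV[R]_(q k) -> R).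

Definition opt_index (X : Omega -> T) : 'I_m.+1 :=
  min_argmin (fun k => minimum [set risk (@lk k) X theta | theta in @TT k]).

Definition est_index (X_ : nat -> Omega -> T)
    (Pen : 'I_m.+1 -> nat -> Omega -> R) (n : nat) (w : Omega) : 'I_m.+1 :=
  min_argmin (fun k =>
    minimum [set emp_risk (@lk k) X_ n theta w | theta in @TT k] + Pen k n w).

End Risks.

(* Main.v *)
Require Import Defs.
From mathcomp Require Import measurable_realfun lebesgue_measure ring lra zify.

Set Implicit Arguments.
Unset Strict Implicit.
Unset Printing Implicit Defensive.

(** Write [theta_k] for the minimiser of the risk [r_k], and [R_k] for the
    empirical risk of a sample of size [n]. Everything rests on one estimate,
    [emp_risk_lower_bound]: outside an event of small probability,
    [n * (R_k theta - R_k theta_k) >= - K] for all [theta] at once, with [K]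
    independent of [n]. Thus [n * min R_k] is [n * R_k theta_k], up to an error
    that is bounded in probability on the only side that matters, since
    [min R_k <= R_k theta_k] is trivial for the index to be selected.

    Granted this, each competitor [l] of the optimal index [k] is beaten with
    probability tending to one. If [l] has the same minimal risk, then [l] is
    larger than [k], the difference [n * (R_l theta_l - R_k theta_k)] is bounded
    in probability by assumption, and the penalty gap, multiplied by [n], tends
    to infinity. If [l] has a larger minimal risk, then [R_l theta_l] and
    [R_k theta_k] are within [O(1 / sqrt n)] of their means
    ([emp_risk_concentration]), which leaves a gap that the vanishing penalty of
    [k] cannot fill.

    The estimate is proved by chaining and peeling. The loss is Lipschitz in the
    parameter with a random constant [C] which is only square integrable, so
    neither subgaussian increments nor bounded differences are available.
    Instead, the inequality [exp (y - y^2) <= 1 + y + y^2], true for every real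
    [y], makes [sum (lam Z_i - lam^2 Z_i^2)] have a bounded exponential moment
    whatever the tails of [Z] ([self_normalised_deviation]). Taking
    [lam = 1 / (rho * sqrt n)] when [|Z| <= rho * C], the quadratic terms add up
    to the empirical mean of [C^2], which is bounded in probability and is the
    same for all increments. So the increments of the centred empirical process
    over pairs at distance [rho] have exponential tails at scale
    [rho * sqrt n] ([sum_deviation]), which suffices for chaining along dyadic
    nets in finite dimension ([chaining_deviation]): on the ball of radius [rho]
    about [theta_k] the process is at least [- rho * sqrt n * O(1)]. Applied to
    the radii [2^i / sqrt n], this is dominated, on the [i]-th shell, by the
    quadratic growth [c * 4^i / 4] of [n * r_k], up to a constant
    ([uniform_lower_bound]).

    The minima over [theta] exist only almost surely, where the losses are
    Lipschitz; there they agree with an infimum over a countable dense set,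
    which is measurable ([measurable_min_emp_risk]). *)

(** * An exponential inequality *)

(** Since [exp (y^2 - y) >= 1 - y + y^2], the product of this lower bound with
    the right-hand side, [1 + y^2 + y^4], is at least [1]. *)
Lemma expR_sub_sqr_le (R : realType) (y : R) : expR (y - y ^+ 2) <= 1 + y + y ^+ 2.
Proof.
have e1 : 0 < 1 - y + y ^+ 2 by have := sqr_ge0 (y - 2^-1); nra.
have le1 : 1 - y + y ^+ 2 <= expR (y ^+ 2 - y).
  by apply: le_trans (expR_ge1Dx _); lra.
have -> : y - y ^+ 2 = - (y ^+ 2 - y) by rewrite opprB.
rewrite expRN -[leLHS]mul1r ler_pdivrMr ?expR_gt0//.
have p2 : 0 < 1 + y + y ^+ 2 by have := sqr_ge0 (y + 2^-1); nra.
apply: le_trans (ler_wpM2l (ltW p2) le1).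
have := sqr_ge0 (y ^+ 2); have := sqr_ge0 y; nra.
Qed.

Lemma expRN_inv_le (R : realType) (e : R) : 0 < e -> expR (- e^-1) <= e.
Proof.
move=> e0; rewrite expRN -[leRHS]invrK lef_pV2 ?posrE ?expR_gt0 ?invr_gt0//.
by apply: le_trans (expR_ge1Dx _); rewrite lerDr.
Qed.

Lemma exp2_le_expR (R : realType) (k : nat) : (2 ^ k)%:R <= expR k%:R :> R.
Proof.
rewrite -[X in expR X]mulr1 expRM_natl natrX lerXn2r ?nnegrE ?expR_ge0//.
by apply: le_trans (expR_ge1Dx _).
Qed.

(** * Expectation of a product over an independent sample *)

Section IndependentProduct.
Context {R : realType} {dO : measure_display} {Omega : measurableType dO}.
Variable P : probability Omega R.
Context {dT : measure_display} {T : measurableType dT}.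
Import HBNNSimple.
Local Open Scope ereal_scope.

(** Passing from indicators to nonnegative functions of [Y]: both sides are
    linear in [g] and continuous under nondecreasing limits. *)
Lemma integral_mul_comp_from_indic (phi : Omega -> R) (Y : Omega -> T)
    (c : R) (g : T -> R) :
  measurable_fun setT phi -> (forall w, (0 <= phi w)%R) ->
  measurable_fun setT Y -> (0 <= c)%R ->
  (forall A, measurable A ->
     \int[P]_w (phi w * \1_A (Y w))%:E = c%:E * P (Y @^-1` A)) ->
  measurable_fun setT g -> (forall x, (0 <= g x)%R) ->
  \int[P]_w (phi w * g (Y w))%:E = c%:E * \int[P]_w (g (Y w))%:E.
Proof.
move=> mphi phi0 mY c0 hA mg g0.
have meg : measurable_fun setT (fun x => (g x)%:E) by exact/measurable_EFinP.
pose h := nnsfun_approx (@measurableT _ T) meg.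
have mh n : measurable_fun setT (h n \o Y).
  by apply: measurableT_comp.
have cvh x : (h n x)%:E @[n --> \oo] --> (g x)%:E.
  by apply: (cvg_nnsfun_approx measurableT meg) => // t _; rewrite /= lee_fin.
have ndh x : {homo (fun n => h n x) : a b / (a <= b)%N >-> (a <= b)%R}.
  by move=> a b ab; exact/lefP/(nd_nnsfun_approx measurableT meg).
have -> : \int[P]_w (g (Y w))%:E = lim (\int[P]_w (h n (Y w))%:E @[n --> \oo]).
  rewrite -monotone_convergence//.
  - by apply: eq_integral => w _; apply/esym/cvg_lim => //; exact: cvh.
  - by move=> n; apply/measurable_EFinP; exact: mh.
  - by move=> n w _; rewrite lee_fin.
  - by move=> w _ a b ab; rewrite lee_fin ndh.
have -> : \int[P]_w (phi w * g (Y w))%:E =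
    lim (\int[P]_w (phi w * h n (Y w))%:E @[n --> \oo]).
  rewrite -monotone_convergence//.
  - apply: eq_integral => w _; apply/esym/cvg_lim => //.
    under eq_fun do rewrite EFinM.
    rewrite EFinM; apply: cvgeZl => //; exact: cvh.
  - by move=> n; apply/measurable_EFinP; apply: measurable_funM => //; exact: mh.
  - by move=> n w _; rewrite lee_fin mulr_ge0.
  - by move=> w _ a b ab; rewrite lee_fin ler_wpM2l// ndh.
have suf n : \int[P]_w (phi w * h n (Y w))%:E = c%:E * \int[P]_w (h n (Y w))%:E.
  have mind r : measurable (h n @^-1` [set r]).
    by rewrite -[X in measurable X]setTI; apply: measurable_funP => //; exact: measurable_set1.
  have mi r : measurable_fun setT (fun w => (r * \1_(h n @^-1` [set r]) (Y w))%R).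
    apply: measurable_funM => //.
    exact: (measurableT_comp (measurable_indic (mind r)) mY).
  transitivity (\int[P]_w (\sum_(r \in range (h n))
      (phi w * (r * \1_(h n @^-1` [set r]) (Y w)))%:E)).
    apply: eq_integral => w _.
    rewrite fsumEFin // {1}(fimfunE (h n)) mulr_fsumr//.
  rewrite ge0_integral_fsum//; last 2 first.
  - move=> r; apply/measurable_EFinP; exact: measurable_funM.
  - by move=> r w _; rewrite lee_fin mulr_ge0// -lee_fin nnfun_muleindic_ge0.
  transitivity (c%:E * \int[P]_w (\sum_(r \in range (h n))
      (r * \1_(h n @^-1` [set r]) (Y w))%:E)); last first.
    congr (_ * _); apply: eq_integral => w _.
    by rewrite fsumEFin // {1}(fimfunE (h n)).
  rewrite ge0_integral_fsum//; last 2 first.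
  - by move=> r; apply/measurable_EFinP.
  - by move=> r w _; exact: nnfun_muleindic_ge0.
  rewrite ge0_mule_fsumr; last first.
    by move=> r; apply: integral_ge0 => w _; exact: nnfun_muleindic_ge0.
  apply: eq_fsbigr => r; rewrite inE => -[x _ <-].
  set A := h n @^-1` _.
  have mA : measurable_fun setT (fun w => (\1_A (Y w) : R)).
    exact: (measurableT_comp (measurable_indic (mind _)) mY).
  have -> : \int[P]_w (phi w * (h n x * \1_A (Y w)))%:E =
      (h n x)%:E * \int[P]_w (phi w * \1_A (Y w))%:E.
    rewrite -ge0_integralZl_EFin//.
    - by apply: eq_integral => w _; rewrite -EFinM mulrCA.
    - by move=> w _; rewrite lee_fin mulr_ge0.
    - by apply/measurable_EFinP; exact: measurable_funM.
  have -> : \int[P]_w (h n x * \1_A (Y w))%:E = (h n x)%:E * P (Y @^-1` A).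
    have mYA : measurable (Y @^-1` A).
      by rewrite -[Y @^-1` A]setTI; apply: mY => //; exact: mind.
    rewrite -[Y @^-1` A]setIT -integral_indic// -ge0_integralZl_EFin//.
    by apply/measurable_EFinP; exact: measurable_indic.
  rewrite hA; [exact: muleCA | exact: mind].
under eq_fun do rewrite suf.
apply/cvg_lim => //; apply: cvgeZl => //.
apply: ereal_nondecreasing_is_cvgn => a b ab.
apply: ge0_le_integral => //.
- by move=> w _; rewrite lee_fin.
- by apply/measurable_EFinP; exact: mh.
- by apply/measurable_EFinP; exact: mh.
- by move=> w _; rewrite lee_fin ndh.
Qed.

(** The factors are turned from indicators, for which this is the definition of
    independence, into arbitrary functions one index at a time. Integrability
    makes the product of the other integrals a real constant. *)
Lemma integral_prod_independent (X_ : nat -> {RV P >-> T}) (n : nat)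
    (G : nat -> T -> R) :
  mutually_independent X_ ->
  (forall i, measurable_fun setT (G i)) -> (forall i x, (0 <= G i x)%R) ->
  (forall i, \int[P]_w (G i (X_ i w))%:E < +oo) ->
  \int[P]_w (\prod_(i < n) G i (X_ i w))%:E =
  \prod_(i < n) \int[P]_w (G i (X_ i w))%:E.
Proof.
move=> indep.
have mX i A : measurable A -> measurable (X_ i @^-1` A).
  by move=> mA; rewrite -[X in measurable X]setTI; apply: measurable_funP.
have mGX (g : T -> R) i : measurable_fun setT g ->
    measurable_fun setT (fun w => g (X_ i w)).
  by move=> mg; exact: (measurableT_comp mg (measurable_funP (X_ i))).
(* The factors of index at least k are still indicators. *)
suff gen k : forall G : nat -> T -> R,
    (forall i, (k <= i < n)%N -> exists2 A, measurable A & G i = \1_A) ->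
    (forall i, measurable_fun setT (G i)) -> (forall i x, (0 <= G i x)%R) ->
    (forall i, \int[P]_w (G i (X_ i w))%:E < +oo) ->
    \int[P]_w (\prod_(i < n) G i (X_ i w))%:E =
    \prod_(i < n) \int[P]_w (G i (X_ i w))%:E.
  by apply: (gen n) => i /andP[/leq_ltn_trans/[apply]]; rewrite ltnn.
elim: k => [|k IH] {}G GA mG G0 Gfin.
  have /choice[A hA] : forall i, exists A, measurable A /\ ((i < n)%N -> G i = \1_A).
    move=> i; case: (ltnP i n) => [ilt|_]; last by exists setT.
    by have [B mB GB] := GA i ilt; exists B.
  have mA i : measurable (A i) by case: (hA i).
  have GE i : (i < n)%N -> G i = \1_(A i) by case: (hA i).
  have := indep (iota 0 n) A (iota_uniq _ _) mA.
  rewrite -{2}[n]subn0 big_mkord => E0.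
  transitivity (P (\bigcap_(i in [set` iota 0 n]) X_ i @^-1` A i)); last first.
    rewrite E0; apply: eq_bigr => i _; rewrite GE//.
    under eq_integral do rewrite -[\1_(A i) _]/(\1_(X_ i @^-1` A i) _).
    by rewrite integral_indic// ?setIT//; exact: mX.
  have mI : measurable (\bigcap_(i in [set` iota 0 n]) X_ i @^-1` A i).
    by apply: bigcap_measurableType => i _; exact: mX.
  rewrite -[X in P X]setIT -integral_indic//; apply: eq_integral => w _.
  congr (_%:E); rewrite indicE; case: (boolP (w \in _)) => [|].
    rewrite inE => wA; apply: big1 => i _; rewrite GE// indicE mem_set//.
    by apply: (wA i); rewrite /= mem_iota add0n; exact: ltn_ord.
  rewrite notin_setE => wA.
  have [i ilt wi] : exists2 i, (i < n)%N & ~ A i (X_ i w).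
    apply: contrapT => h; apply: wA => i; rewrite /= mem_iota add0n => ilt.
    by apply: contrapT => wi; apply: h; exists i.
  rewrite (bigD1 (Ordinal ilt))//= GE// indicE memNset// mul0r//.
case: (ltnP k n) => [kn|nk]; last first.
  apply: IH => // i /andP[ki ilt]; apply: GA; rewrite ilt andbT.
  by have := leq_ltn_trans nk (leq_ltn_trans ki ilt); rewrite ltnn.
pose phi w := (\prod_(i < n | i != Ordinal kn) G i (X_ i w))%R.
have Ifin i : \int[P]_w (G i (X_ i w))%:E \is a fin_num.
  rewrite ge0_fin_numE//; apply: integral_ge0 => w _; rewrite lee_fin//.
pose c := (\prod_(i < n | i != Ordinal kn) fine (\int[P]_w (G i (X_ i w))%:E))%R.
have cE : c%:E = \prod_(i < n | i != Ordinal kn) \int[P]_w (G i (X_ i w))%:E.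
  rewrite /c; elim/big_ind2 : _ => // [x1 x2 y1 y2 <- <-|i _]; first by rewrite EFinM.
  by rewrite fineK.
rewrite [RHS](bigD1 (Ordinal kn))//= -cE muleC.
under eq_integral => w _ do rewrite (bigD1 (Ordinal kn))//= mulrC.
apply: (@integral_mul_comp_from_indic phi (X_ k) c (G k)) => //.
- rewrite /phi; under eq_fun do rewrite -big_filter.
  by apply: measurable_prod => i _; exact: mGX.
- by move=> w; apply: prodr_ge0.
- by apply: prodr_ge0 => i _; apply: fine_ge0; apply: integral_ge0 => w _; rewrite lee_fin.
move=> A mA.
pose G' i := if i == k then (\1_A : T -> R) else G i.
have G'k : G' k = \1_A by rewrite /G' eqxx.
have G'N i : i != Ordinal kn -> G' i = G i by rewrite /G' -val_eqE /= => /negbTE ->.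
have PA : \int[P]_w (G' k (X_ k w))%:E = P (X_ k @^-1` A).
  rewrite G'k; under eq_integral do rewrite -[\1_A _]/(\1_(X_ k @^-1` A) _).
  by rewrite integral_indic// ?setIT//; exact: mX.
have := IH G'; rewrite [X in _ = X](bigD1 (Ordinal kn))//= PA.
rewrite (eq_bigr (fun i : 'I_n => \int[P]_w (G i (X_ i w))%:E)); last first.
  by move=> i ik; rewrite G'N.
rewrite -cE muleC => <-.
- apply: eq_integral => w _; rewrite [in RHS](bigD1 (Ordinal kn))//= G'k mulrC.
  by congr (_ * _)%:E; apply: eq_bigr => i ik; rewrite G'N.
- move=> i /andP[ki ilt]; rewrite /G'; case: eqVneq => ik; first by exists A.
  by apply: GA; rewrite ilt andbT ltn_neqAle eq_sym ik.
- by move=> i; rewrite /G'; case: ifP => // _; exact: measurable_indic.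
- by move=> i x; rewrite /G'; case: ifP => // _; rewrite indicE.
- move=> i; case: (eqVneq i k) => [->|ik]; last by rewrite /G' (negbTE ik).
  by rewrite PA (le_lt_trans (probability_le1 _ _)) ?ltry//; exact: mX.
Qed.

End IndependentProduct.

(** * A self-normalised deviation inequality *)

Section Deviation.
Context {R : realType} {dO : measure_display} {Omega : measurableType dO}.
Variable P : probability Omega R.
Context {dT : measure_display} {T : measurableType dT}.

Lemma measurable_compRV (X : {RV P >-> T}) (f : T -> R) :
  measurable_fun setT f -> measurable_fun setT (fun w => f (X w)).
Proof. by move=> mf; exact: (measurableT_comp mf (measurable_funP X)). Qed.

Lemma integrable_addR (f g : Omega -> R) :
  P.-integrable setT (EFin \o f) -> P.-integrable setT (EFin \o g) ->
  P.-integrable setT (EFin \o (fun w => f w + g w)).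
Proof. by move=> fi gi; exact: (integrableD measurableT fi gi). Qed.

Lemma integrable_scaleR (k : R) (f : Omega -> R) :
  P.-integrable setT (EFin \o f) -> P.-integrable setT (EFin \o (fun w => k * f w)).
Proof. by move=> fi; exact: (integrableZl measurableT k fi). Qed.

Lemma integrable_constR (k : R) : P.-integrable setT (EFin \o (fun=> k)).
Proof. exact: finite_measure_integrable_cst. Qed.

Lemma integrable_sqr (f : Omega -> R) :
  measurable_fun setT f -> finite_second_moment P f ->
  P.-integrable setT (EFin \o (fun w => f w ^+ 2)).
Proof.
rewrite /finite_second_moment unlock => mf fin; apply/integrableP; split.
  by apply/measurable_EFinP; exact: measurable_funX.
apply: le_lt_trans fin; rewrite le_eqVlt; apply/orP; left; apply/eqP.
by apply: eq_integral => w _ /=; rewrite ger0_norm// sqr_ge0.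
Qed.

Lemma integrable_sqrW (f : Omega -> R) :
  measurable_fun setT f -> finite_second_moment P f ->
  P.-integrable setT (EFin \o f).
Proof.
move=> mf fin; have i2 := integrable_sqr mf fin.
have i1 : P.-integrable setT (EFin \o (fun w => 1 + f w ^+ 2)).
  exact: (integrable_addR (integrable_constR 1) i2).
apply: le_integrable i1 => //; first exact/measurable_EFinP.
move=> w /=; rewrite lee_fin [leRHS]ger0_norm ?addr_ge0 ?sqr_ge0// ler_norml.
by have := sqr_ge0 (f w - 1); have := sqr_ge0 (f w + 1); nra.
Qed.

Lemma integral_fineK (f : Omega -> R) : P.-integrable setT (EFin \o f) ->
  (\int[P]_w (f w)%:E)%E = (\int[P]_w f w)%:E.
Proof. by move=> fi; rewrite /Rintegral fineK//; exact: integrable_fin_num. Qed.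

Lemma same_distribution_integral (Y Z : {RV P >-> T}) (f : T -> R) :
  same_distribution Y Z -> measurable_fun setT f -> (forall x, 0 <= f x) ->
  (\int[P]_w (f (Y w))%:E = \int[P]_w (f (Z w))%:E)%E.
Proof.
move=> YZ mf f0.
have mf' : measurable_fun setT (fun x => (f x)%:E) by exact/measurable_EFinP.
have f0' y : (0 <= (f y)%:E)%E by rewrite lee_fin.
rewrite -(ge0_integral_distribution Y mf' f0') -(ge0_integral_distribution Z mf' f0').
by apply: eq_measure_integral => A mA _; exact: YZ.
Qed.

Lemma same_distribution_ae (Y Z : {RV P >-> T}) (Q : T -> Prop) :
  same_distribution Y Z -> (\forall x \ae distribution P Z, Q x) ->
  \forall w \ae P, Q (Y w).
Proof.
move=> YZ [N [mN N0 QN]]; exists (Y @^-1` N); split.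
- by rewrite -[Y @^-1` N]setTI; exact: (measurable_funP Y).
- by have := YZ _ mN; rewrite N0.
- by move=> w /= nQ; exact: QN.
Qed.

(** Exponential Markov inequality. The subtracted squares tame the tails of [Z],
    so that a second moment is enough. *)
Lemma self_normalised_deviation (X : {RV P >-> T}) (X_ : nat -> {RV P >-> T})
    (Z : T -> R) (n : nat) (lam v : R) :
  mutually_independent X_ -> (forall i, same_distribution (X_ i) X) ->
  measurable_fun setT Z -> finite_second_moment P (fun w => Z (X w)) ->
  let B := [set w | v + n%:R * (lam * (\int[P]_w Z (X w)) +
                     lam ^+ 2 * (\int[P]_w (Z (X w) ^+ 2))) <=
     \sum_(i < n) (lam * Z (X_ i w) - (lam * Z (X_ i w)) ^+ 2)] in
  measurable B /\ (P B <= (expR (- v))%:E)%E.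
Proof.
move=> indep same mZ fin; set mu := lam * _ + _ => B.
have mB : measurable B.
  rewrite -[B]setTI; apply: measurable_fun_ler => //.
  apply: measurable_sum => i.
  by apply: measurable_funB; [|apply: measurable_funX];
    apply: measurable_funM => //; exact: measurable_compRV.
split=> //.
(* Normalised so that every factor has expectation at most 1. *)
pose G (x : T) := expR (lam * Z x - (lam * Z x) ^+ 2 - mu).
have mG : measurable_fun setT G.
  apply: measurableT_comp => //; apply: measurable_funB => //.
  by apply: measurable_funB; [|apply: measurable_funX];
    apply: measurable_funM.
have G0 x : 0 <= G x by exact: expR_ge0.
have mZX := measurable_compRV X mZ.
have i1 := integrable_sqrW mZX fin.
have i2 := integrable_sqr mZX fin.
have EG : (\int[P]_w (G (X w))%:E <= 1)%E.
  pose q w := 1 + lam * Z (X w) + lam ^+ 2 * Z (X w) ^+ 2.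
  have iq1 : P.-integrable setT (EFin \o (fun w => lam * Z (X w))).
    exact: integrable_scaleR.
  have iq2 : P.-integrable setT (EFin \o (fun w => lam ^+ 2 * Z (X w) ^+ 2)).
    exact: integrable_scaleR.
  have i0 : P.-integrable setT (EFin \o (fun w => (1 : R))).
    exact: integrable_constR.
  have iq01 : P.-integrable setT (EFin \o (fun w => 1 + lam * Z (X w))).
    exact: integrable_addR.
  have iq : P.-integrable setT (EFin \o q).
    exact: integrable_addR.
  have Eq : \int[P]_w q w = 1 + mu.
    rewrite /q RintegralD// RintegralD// RintegralZl// RintegralZl//.
    have -> : \int[P]_w (1 : R) = 1.
      by have := expectation_cst P 1; rewrite unlock /Rintegral /= => ->.
    by rewrite addrA.
  apply: (@le_trans _ _ (\int[P]_w ((expR (- mu))%:E * (q w)%:E))%E).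
    apply: ge0_le_integral => //.
    - by move=> w _; rewrite lee_fin.
    - by apply/measurable_EFinP; exact: measurable_compRV.
    - apply/measurable_EFinP; apply: measurable_funM => //.
      by move/measurable_int: iq => /measurable_EFinP.
    - move=> w _; rewrite -EFinM lee_fin /G expRD mulrC ler_wpM2l ?expR_ge0//.
      by rewrite /q; apply: le_trans (expR_sub_sqr_le _) _; rewrite exprMn.
  rewrite ge0_integralZl_EFin ?expR_ge0//; last 2 first.
  - move=> w _; rewrite lee_fin /q -exprMn.
    by have := sqr_ge0 (lam * Z (X w) + 2^-1); nra.
  - by move/measurable_int: iq.
  rewrite integral_fineK// Eq -EFinM lee_fin expRN mulrC ler_pdivrMr ?expR_gt0//.
  by rewrite mul1r expR_ge1Dx.
have EGi i : (\int[P]_w (G (X_ i w))%:E <= 1)%E.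
  by rewrite (same_distribution_integral (same i)).
have prodE : (\int[P]_w (\prod_(i < n) G (X_ i w))%R%:E <= 1)%E.
  rewrite (@integral_prod_independent _ _ _ P _ _ X_ n (fun=> G))//; last first.
    by move=> i; rewrite (le_lt_trans (EGi i))// ltry.
  have h : (0 <= \prod_(i < n) \int[P]_w (G (X_ i w))%:E <= 1)%E.
    elim/big_ind : _ => //; first by rewrite lexx lee_fin ler01.
      move=> x y /andP[x0 x1] /andP[y0 y1]; rewrite mule_ge0//=.
      by rewrite -[leRHS]mule1; apply: lee_pmul.
    move=> i _; rewrite EGi andbT; apply: integral_ge0 => w _; rewrite lee_fin//.
  by case/andP: h.
have mprod : measurable_fun setT (fun w => \prod_(i < n) G (X_ i w)).
  by apply: measurable_prod => i _; exact: measurable_compRV.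
have p0 w : 0 <= \prod_(i < n) G (X_ i w) by apply: prodr_ge0.
rewrite -[B]setIT -integral_indic//.
apply: (@le_trans _ _ (\int[P]_w ((expR (- v))%:E * (\prod_(i < n) G (X_ i w))%R%:E))%E).
  apply: ge0_le_integral => //.
  - by apply/measurable_EFinP; exact: measurable_indic.
  - by apply/measurable_EFinP; exact: measurable_funM.
  - move=> w _; rewrite -EFinM lee_fin indicE; case: (boolP (w \in B)) => [|_]; last first.
      by rewrite mulr_ge0// expR_ge0.
    rewrite inE /B /= => Bw; rewrite /G -expR_sum -expRD -[leLHS]expR0 ler_expR.
    rewrite sumrB sumr_const card_ord -mulr_natl.
    by move: Bw; lra.
rewrite ge0_integralZl_EFin ?expR_ge0//; last 2 first.
- by move=> w _; rewrite lee_fin.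
- exact/measurable_EFinP.
by rewrite -[leRHS]mule1 lee_pmul2l// lte_fin expR_gt0.
Qed.

End Deviation.

(** * Properties that hold outside a small event *)

Section HoldsOutside.
Context {R : realType} {dO : measure_display} {Omega : measurableType dO}.
Variable P : probability Omega R.

(** The property need not be measurable, and may fail on a further null set:
    suprema over uncountable parameter sets are covered in this way. *)
Definition holds_outside (eps : R) (Q : Omega -> Prop) : Prop :=
  exists B, [/\ measurable B, (P B <= eps%:E)%E & \forall w \ae P, ~ B w -> Q w].

Lemma holds_outside_ae (Q : Omega -> Prop) :
  (\forall w \ae P, Q w) -> holds_outside 0 Q.
Proof.
move=> aeQ; exists set0; rewrite measure0; split => //.
by apply: filterS aeQ => w.
Qed.

Lemma holds_outside_measurable (eps : R) (B : set Omega) :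
  measurable B -> (P B <= eps%:E)%E -> holds_outside eps (fun w => ~ B w).
Proof. by move=> mB PB; exists B; split => //; exact: aeW. Qed.

Lemma holds_outsideS (e1 e2 : R) (Q1 Q2 : Omega -> Prop) :
  e1 <= e2 -> (forall w, Q1 w -> Q2 w) -> holds_outside e1 Q1 -> holds_outside e2 Q2.
Proof.
move=> e12 Q12 [B [mB PB aeQ]]; exists B; split => //.
  by rewrite (le_trans PB)// lee_fin.
by apply: filterS aeQ => w h /h /Q12.
Qed.

Lemma holds_outsideI (e1 e2 : R) (Q1 Q2 : Omega -> Prop) :
  holds_outside e1 Q1 -> holds_outside e2 Q2 ->
  holds_outside (e1 + e2) (fun w => Q1 w /\ Q2 w).
Proof.
move=> [B1 [mB1 PB1 aeQ1]] [B2 [mB2 PB2 aeQ2]]; exists (B1 `|` B2); split.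
- exact: measurableU.
- by rewrite EFinD (le_trans (measureU2 _ _ _))// leeD.
- by apply: filterS2 aeQ1 aeQ2 => w h1 h2 /not_orP[/h1 ? /h2].
Qed.

Lemma holds_outside_forall_seq (I : eqType) (s : seq I) (e : R)
    (Q : I -> Omega -> Prop) :
  (forall i, i \in s -> holds_outside e (Q i)) ->
  holds_outside ((size s)%:R * e) (fun w => forall i, i \in s -> Q i w).
Proof.
elim: s => [|i s IH] hQ /=.
  by rewrite mul0r; apply: holds_outside_ae; apply: aeW => w i.
have h1 := hQ i (mem_head _ _).
have h2 : holds_outside ((size s)%:R * e) (fun w => forall i, i \in s -> Q i w).
  by apply: IH => j js; apply: hQ; rewrite in_cons js orbT.
have := holds_outsideI h1 h2; apply: holds_outsideS.
  by rewrite mulrSr mulrDl mul1r addrC.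
by move=> w [Qi Qs] j; rewrite in_cons => /predU1P[->//|]; exact: Qs.
Qed.

Lemma holds_outside_forall_nat (e : R) (Q : nat -> Omega -> Prop) : 0 <= e ->
  (forall i, holds_outside (e / (2 ^ i.+1)%:R) (Q i)) ->
  holds_outside e (fun w => forall i, Q i w).
Proof.
move=> e0 /choice[B hB]; exists (\bigcup_i B i); split.
- by apply: bigcupT_measurable => i; case: (hB i).
- apply: (@le_trans _ _ (\sum_(i <oo) P (B i))%E).
    apply: measure_sigma_subadditive => //.
    + by move=> i; case: (hB i).
    + by apply: bigcupT_measurable => i; case: (hB i).
  apply: le_trans (epsilon_trick0 xpredT e0).
  by apply: lee_nneseries => // i _; case: (hB i).
- have : \forall w \ae P, forall i, ~ B i w -> Q i w.
    by apply: ae_foralln => i; case: (hB i).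
  by apply: filterS => w h nB i; apply: h => Bi; apply: nB; exists i.
Qed.

End HoldsOutside.

(** * Finite nets in sup-norm balls *)

Definition lipschitz_bounded (R : realType) (V : normedModType R) (A : set V)
    (f : V -> R) : Prop :=
  exists L, forall p p', A p -> A p' -> `|f p - f p'| <= L * `|p - p'|.

Section Nets.
Context {R : realType} {q : nat}.
Implicit Types (T : set 'rV[R]_q).

Lemma rV_norm_le (v : 'rV[R]_q) (e : R) : 0 <= e ->
  (forall i, `|v ord0 i| <= e) -> `|v| <= e.
Proof.
move=> e0 h; rewrite -[`|v|]/(mx_norm v) mx_normrE.
by apply: (big_ind (fun z => z <= e)) => // [x y xe ye|[i j] _]; [rewrite ge_max xe|rewrite (ord1 i)].
Qed.

Lemma rV_le_norm (v : 'rV[R]_q) i : `|v ord0 i| <= `|v|.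
Proof.
rewrite -[`|v|]/(mx_norm v) mx_normrE.
exact: (le_bigmax _ (fun k : 'I_1 * 'I_q => `|v k.1 k.2|) (ord0, i)).
Qed.

(** The enclosing cube is cut into cells of side [rho / 2 ^+ s], and one point of
    [T] is chosen in each cell that meets [T]. There are [2 ^ s.+1 + 1] cells in
    each direction, the last one for the closed upper face. *)
Lemma finite_net T (th0 : 'rV[R]_q) (rho : R) (s : nat) : 0 < rho ->
  (forall th, T th -> `|th - th0| <= rho) ->
  exists F : seq 'rV[R]_q,
    [/\ forall p, p \in F -> T p,
        forall th, T th -> exists2 p, p \in F & `|th - p| <= rho / 2 ^+ s &
        (size F <= 4 ^ (s.+1 * q))%N].
Proof.
move=> rho0 Trho.
pose k (x : R) := Num.truncn ((x + rho) * (2 ^+ s / rho)).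
pose N := (2 ^ s.+1)%N.
pose cell (th : 'rV[R]_q) : {ffun 'I_q -> 'I_N.+1} :=
  [ffun i => inord (k ((th - th0) ord0 i))].
pose rep c := xget th0 [set th | T th /\ cell th = c].
pose F := [seq rep c | c in [pred c | `[< exists th, T th /\ cell th = c >]]].
have repP c : (exists th, T th /\ cell th = c) -> T (rep c) /\ cell (rep c) = c.
  by move=> [th h]; exact: (xgetPex th0 (ex_intro (fun th => T th /\ cell th = c) th h)).
have s0 : 0 < 2 ^+ s / rho :> R by rewrite divr_gt0// exprn_gt0.
have near x y : `|x| <= rho -> `|y| <= rho -> k x = k y -> `|x - y| <= rho / 2 ^+ s.
  rewrite !ler_norml => /andP[x1 x2] /andP[y1 y2] kxy.
  have /andP[a1 a2] : (k x)%:R <= (x + rho) * (2 ^+ s / rho) < (k x).+1%:R.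
    by apply: truncn_itv; apply: mulr_ge0; [lra|exact: ltW].
  have /andP[b1 b2] : (k y)%:R <= (y + rho) * (2 ^+ s / rho) < (k y).+1%:R.
    by apply: truncn_itv; apply: mulr_ge0; [lra|exact: ltW].
  rewrite kxy in a1 a2; have : (k y).+1%:R = (k y)%:R + 1 :> R by rewrite natr1.
  move=> kS; rewrite kS in a2 b2.
  have : `|(x - y) * (2 ^+ s / rho)| <= 1 by rewrite ler_norml; lra.
  by rewrite normrM (gtr0_norm s0) -ler_pdivlMr// div1r invf_div ler_norml.
exists F; split.
- by move=> p /fintype.imageP[c]; rewrite inE => /asboolP/asboolP exc ->; case: (repP _ exc).
- move=> th Tth; exists (rep (cell th)).
    by apply/fintype.imageP; exists (cell th) => //; rewrite inE; do 2 apply/asboolP; exists th.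
  have [Tr cr] := repP (cell th) (ex_intro _ th (conj Tth erefl)).
  apply: rV_norm_le => [|i]; first by rewrite divr_ge0 ?exprn_ge0 ?ltW.
  have kN v : T v -> (k ((v - th0)%R ord0 i) < N.+1)%N.
    move=> Tv; have := le_trans (rV_le_norm _ i) (Trho _ Tv).
    rewrite ler_norml => /andP[v1 v2]; rewrite truncn_lt_nat; last first.
      by apply: mulr_ge0; [lra|exact: ltW].
    rewrite mulrA ltr_pdivrMr// -[N.+1%:R]natr1 /N natrX exprSr.
    have p0 : 0 < 2 ^+ s :> R by rewrite exprn_gt0.
    by nra.
  have := congr1 (fun c : {ffun 'I_q -> 'I_N.+1} => val (c i)) cr.
  rewrite ![cell _ _]ffunE /= !inordK ?kN// => /near h.
  have := h (le_trans (rV_le_norm _ i) (Trho _ Tr)) (le_trans (rV_le_norm _ i) (Trho _ Tth)).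
  by rewrite distrC !mxE; congr (`|_| <= _); ring.
- rewrite size_map -cardE (leq_trans (max_card _))// card_ffun !card_ord.
  have NS : (N.+1 <= 4 ^ s.+1)%N by rewrite /N; elim: (s) => // j; rewrite !expnS; lia.
  by rewrite expnM; elim: (q) => // m IH; rewrite (expnS N.+1) (expnS (4 ^ s.+1)) leq_mul.
Qed.

End Nets.

(** * Chaining and peeling for Lipschitz losses *)

Section EmpiricalProcess.
Context {R : realType} {dO : measure_display} {Omega : measurableType dO}.
Variable P : probability Omega R.
Context {dT : measure_display} {T : measurableType dT}.
Variables (X : {RV P >-> T}) (X_ : nat -> {RV P >-> T}).
Hypotheses (indep : mutually_independent X_)
  (same : forall i, same_distribution (X_ i) X).

Lemma second_moment_le (f g : Omega -> R) (rho : R) :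
  measurable_fun setT f -> measurable_fun setT g -> 0 <= rho ->
  finite_second_moment P g -> (\forall w \ae P, `|f w| <= rho * g w) ->
  finite_second_moment P f /\
  \int[P]_w (f w ^+ 2) <= rho ^+ 2 * \int[P]_w (g w ^+ 2).
Proof.
move=> mf mg rho0 fing aefg; have ig := integrable_sqr mg fing.
have le2 : (\int[P]_w (f w ^+ 2)%:E <= \int[P]_w (rho ^+ 2 * g w ^+ 2)%:E)%E.
  apply: ae_ge0_le_integral => //.
  - by move=> w _; rewrite lee_fin sqr_ge0.
  - by apply/measurable_EFinP; exact: measurable_funX.
  - by move=> w _; rewrite lee_fin mulr_ge0 ?sqr_ge0.
  - by apply/measurable_EFinP; apply: measurable_funM => //; exact: measurable_funX.
  apply: filterS aefg => w h _; rewrite lee_fin -exprMn -[f w ^+ 2]real_normK ?num_real//.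
  by rewrite ler_pXn2r// ?nnegrE// (le_trans _ h).
have fin : finite_second_moment P f.
  rewrite /finite_second_moment unlock; apply: le_lt_trans le2 _.
  by rewrite integral_fineK ?ltry//; exact: integrable_scaleR.
split=> //; rewrite -lee_fin -integral_fineK; last exact: integrable_sqr.
by rewrite (le_trans le2)// integral_fineK ?RintegralZl//; exact: integrable_scaleR.
Qed.

Definition sqmean (C : T -> R) (n : nat) (w : Omega) : R :=
  n%:R^-1 * \sum_(i < n) C (X_ i w) ^+ 2.

Lemma sample_ae (Q : T -> Prop) : (\forall x \ae distribution P X, Q x) ->
  \forall w \ae P, forall i, Q (X_ i w).
Proof.
move=> aeQ; apply: ae_foralln => i.
exact: (same_distribution_ae (same i) aeQ).
Qed.

(** The choice [lam = 1 / (rho * sqrt n)] turns the quadratic terms of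
    [self_normalised_deviation] into the empirical and the true second moment of
    the envelope [C], which do not depend on [Z]. *)
Lemma sum_deviation (Z C : T -> R) (rho v : R) (n : nat) :
  measurable_fun setT Z -> measurable_fun setT C ->
  finite_second_moment P (fun w => C (X w)) -> 0 < rho -> (0 < n)%N ->
  (\forall x \ae distribution P X, `|Z x| <= rho * C x) ->
  holds_outside P (expR (- v)) (fun w =>
    \sum_(i < n) Z (X_ i w) - n%:R * (\int[P]_w Z (X w)) <=
    rho * Num.sqrt n%:R * (v + sqmean C n w + \int[P]_w (C (X w) ^+ 2))).
Proof.
move=> mZ mC finC rho0 n0 ZC.
have [finZ Z2] := second_moment_le (measurable_compRV X mZ)
  (measurable_compRV X mC) (ltW rho0) finC
  (same_distribution_ae (fun A _ => erefl) ZC).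
pose sn : R := Num.sqrt n%:R.
have sn0 : 0 < sn by rewrite sqrtr_gt0 ltr0n.
have sn2 : sn ^+ 2 = n%:R by rewrite sqr_sqrtr// ler0n.
have rs0 : 0 < rho * sn by rewrite mulr_gt0.
pose lam := (rho * sn)^-1.
have lamK : (rho * sn) * lam = 1 by rewrite /lam mulfV// gt_eqF.
have [mB PB] := self_normalised_deviation n lam v indep same mZ finZ.
have aeZC := sample_ae ZC.
have := holds_outsideI (holds_outside_measurable mB PB) (holds_outside_ae aeZC).
apply: holds_outsideS; first by rewrite addr0.
move=> w [/negP]; rewrite -ltNge.
set m1 := \int[P]_w Z (X w); set m2 := \int[P]_w (Z (X w) ^+ 2) in Z2 *.
set c2 := \int[P]_w (C (X w) ^+ 2) in Z2 * => hB hZC.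
rewrite -/sn.
have l2 : n%:R * (lam ^+ 2 * m2) <= c2.
  have : n%:R * lam ^+ 2 * m2 <= n%:R * lam ^+ 2 * (rho ^+ 2 * c2).
    by apply: ler_wpM2l => //; rewrite mulr_ge0 ?sqr_ge0.
  have -> : n%:R * lam ^+ 2 * (rho ^+ 2 * c2) = ((rho * sn) * lam) ^+ 2 * c2.
    by rewrite -sn2; ring.
  by rewrite lamK; lra.
have l3 : \sum_(i < n) (lam * Z (X_ i w)) ^+ 2 <= sqmean C n w.
  rewrite /sqmean mulr_sumr; apply: ler_sum => i _.
  have := hZC i; set z := Z _; set c := C _ => zc.
  have z2 : z ^+ 2 <= (rho * c) ^+ 2.
    by rewrite -[z ^+ 2]real_normK ?num_real// ler_pXn2r// ?nnegrE// (le_trans _ zc).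
  have lam2 : lam ^+ 2 * rho ^+ 2 = n%:R^-1.
    by rewrite /lam invfM -sn2 -exprMn -mulrA [_ * rho]mulrC mulrA mulVf ?gt_eqF// mul1r exprVn.
  have := ler_wpM2l (sqr_ge0 lam) z2; rewrite -lam2 !exprMn; lra.
have : lam * (\sum_(i < n) Z (X_ i w) - n%:R * m1) <= v + sqmean C n w + c2.
  rewrite mulrBr mulr_sumr; rewrite sumrB in hB; lra.
move=> h; have := ler_wpM2l (ltW rs0) h.
by rewrite mulrA lamK mul1r.
Qed.

(** The deterministic part of chaining. Each point of a net is joined to the
    coarsest net through one nearby point in every intermediate net; the Lipschitz
    property of [g], whose constant does not enter the bound, passes from the nets
    to all of [T']. *)
Lemma chain_lower_bound (V : normedModType R) (g : V -> R) (T' : set V)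
    (F : nat -> seq V) (del a : nat -> R) (A : R) :
  (forall s p, p \in F s -> T' p) ->
  (forall s p, T' p -> exists2 f, f \in F s & `|p - f| <= del s) ->
  (forall f, f \in F 0%N -> 0 <= g f) ->
  (forall s p f, p \in F s.+1 -> f \in F s -> `|p - f| <= del s ->
     g f - a s <= g p) ->
  (forall S, \sum_(s < S) a s <= A) ->
  lipschitz_bounded T' g ->
  del @ \oo --> (0 : R) ->
  forall p, T' p -> - A <= g p.
Proof.
move=> FT cov g0 link sumA [L lip] del0 p Tp.
have lowF S : forall f, f \in F S -> - \sum_(s < S) a s <= g f.
  elim: S => [|S IH] f fF; first by rewrite big_ord0 oppr0 g0.
  have [f' f'F ff'] := cov S f (FT _ _ fF).
  have := link _ _ _ fF f'F ff'; have := IH _ f'F.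
  by rewrite big_ord_recr /=; lra.
have lowp S : - A - `|L| * del S <= g p.
  have [f fF pf] := cov S p Tp.
  have := lip _ _ Tp (FT _ _ fF); rewrite ler_norml => /andP[h _].
  have h1 := lowF S f fF; have h2 := sumA S.
  have h3 : L * `|p - f| <= `|L| * del S.
    apply: (@le_trans _ _ (`|L| * `|p - f|)).
      by apply: ler_wpM2r => //; exact: ler_norm.
    exact: ler_wpM2l.
  lra.
have cv : (- A - `|L| * del S) @[S --> \oo] --> - A - `|L| * 0.
  by apply: cvgB; [exact: cvg_cst|apply: cvgM => //; exact: cvg_cst].
rewrite mulr0 subr0 in cv.
by apply: (cvgr_to_le cv); apply: nearW => S; exact: lowp.
Qed.

Lemma sum_halving_le (a b : R) (S : nat) : 0 <= a -> 0 <= b ->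
  \sum_(s < S) (b + a * (s + 2)%:R) / 2 ^+ s <= 2 * b + 6 * a.
Proof.
move=> a0 b0.
have -> : \sum_(s < S) (b + a * (s + 2)%:R) / 2 ^+ s =
    2 * b + 6 * a - (2 * b + a * (2 * S%:R + 6)) / 2 ^+ S.
  elim: S => [|S IH]; first by rewrite big_ord0 expr0; field.
  rewrite big_ord_recr /= IH exprS natrD -natr1.
  have : 2 ^+ S != 0 :> R by rewrite expf_neq0// pnatr_eq0.
  by move: (2 ^+ S) => z z0; field.
have : 0 <= (2 * b + a * (2 * S%:R + 6)) / 2 ^+ S.
  rewrite divr_ge0 ?exprn_ge0// addr_ge0 ?mulr_ge0// addr_ge0// mulr_ge0//.
lra.
Qed.

(** The left-hand side is a union bound over all pairs from two consecutive nets: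
    with the deviation level [t + (4 q + 1) (s + 2)] at depth [s], the failure
    probabilities are summable over [s]. *)
Lemma link_count_bound (q s : nat) (t : R) :
  (4 ^ (s.+2 * q) * 4 ^ (s.+1 * q))%:R *
    expR (- (t + (4 * q + 1)%:R * (s + 2)%:R)) <= expR (- t) / (2 ^ s.+1)%:R.
Proof.
have p2 : 0 < (2 ^ s.+1)%:R :> R by rewrite ltr0n expn_gt0.
rewrite ler_pdivlMr// opprD expRD [expR (- (_ * _))]expRN -natrM.
set x := ((4 * q + 1) * (s + 2))%N.
have nx : (4 ^ (s.+2 * q) * 4 ^ (s.+1 * q) * 2 ^ s.+1 <= 2 ^ x)%N.
  rewrite -[4%N]/(2 ^ 2)%N -!expnM -!expnD leq_exp2l// /x; lia.
have -> : (4 ^ (s.+2 * q) * 4 ^ (s.+1 * q))%:R * (expR (- t) / expR x%:R) * (2 ^ s.+1)%:R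
    = expR (- t) * ((4 ^ (s.+2 * q) * 4 ^ (s.+1 * q) * 2 ^ s.+1)%:R / expR x%:R) :> R.
  rewrite [((_ * _)%N * _)%:R]natrM; ring.
rewrite -[leRHS]mulr1 ler_wpM2l ?expR_ge0// ler_pdivrMr ?expR_gt0// mul1r.
by apply: le_trans (exp2_le_expR R x); rewrite ler_nat.
Qed.

(** The quadratic growth at scale [2 ^+ i] beats a linear term in which the
    confidence level [i] of the [i]-th shell appears. As [i ^ 2 <= 4 * 2 ^ i],
    the product [2 ^+ i * 2 i] is at most half of [c * (2 ^+ i) ^+ 2], up to a
    multiple of [2 ^+ i]; then complete the square. *)
Lemma pow2_dominates (c b : R) : 0 < c -> 0 <= b -> exists2 K, 0 <= K &
  forall i : nat, 2 ^+ i * (b + 2 * i%:R) - c * (2 ^+ i) ^+ 2 <= K.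
Proof.
move=> c0 b0.
have sq i : (i%:R : R) ^+ 2 <= 4 * 2 ^+ i.
  have : (i ^ 2 <= 4 * 2 ^ i)%N.
    elim: i => // i IH; case: (leqP 3 i) => [i3|]; last by case: i IH => [|[|[|]]].
    rewrite [(2 ^ i.+1)%N]expnS; have : (i.+1 ^ 2 <= 2 * i ^ 2)%N by nia.
    lia.
  by rewrite -(ler_nat R) natrM !natrX.
(* 2 y <= (c / 8) y^2 + 8 / c, so a = 8 / c absorbs the linear term. *)
pose a := 8 / c; have ca : c * a = 8 by rewrite /a mulrC divfK// gt_eqF.
have a0 : 0 < a by rewrite divr_gt0.
exists (a / 16 * (b + a) ^+ 2); first by rewrite mulr_ge0 ?sqr_ge0//; lra.
move=> i; have := sq i; set x : R := 2 ^+ i; set y : R := i%:R => yx.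
have x0 : 0 < x by rewrite exprn_gt0.
have h1 : 2 * y <= a + c / 2 * x.
  have h2 : 0 <= a * (c * y / 8 - 1) ^+ 2 by rewrite mulr_ge0 ?sqr_ge0// ltW.
  have h3 : a * (c * y / 8 - 1) ^+ 2 = (c * a) * (c * y ^+ 2 / 64) - (c * a) * (y / 4) + a.
    by field.
  rewrite h3 ca in h2.
  have h4 := ler_wpM2l (ltW c0) yx.
  lra.
have h5 : 0 <= a / 16 * ((b + a) - c * x) ^+ 2 by rewrite mulr_ge0 ?sqr_ge0//; lra.
have h6 : a / 16 * ((b + a) - c * x) ^+ 2 =
    a / 16 * (b + a) ^+ 2 - (c * a) / 8 * x * (b + a) + (c * a) * (c * x ^+ 2 / 16).
  by field.
rewrite h6 ca in h5.
have h7 := ler_wpM2l (ltW x0) h1.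
lra.
Qed.

(** Markov's inequality. *)
Lemma sqmean_tight (C : T -> R) (n : nat) (L : R) : (0 < n)%N ->
  measurable_fun setT C -> finite_second_moment P (fun w => C (X w)) -> 0 < L ->
  holds_outside P ((\int[P]_w (C (X w) ^+ 2)) / L) (fun w => sqmean C n w <= L).
Proof.
move=> n0 mC finC L0.
have mCX i : measurable_fun setT (fun w => C (X_ i w) ^+ 2).
  by apply: measurable_funX; exact: measurable_compRV.
have msq : measurable_fun setT (sqmean C n).
  by apply: measurable_funM => //; exact: measurable_sum.
have sq0 w : 0 <= sqmean C n w.
  by rewrite mulr_ge0 ?invr_ge0// sumr_ge0// => i _; exact: sqr_ge0.
pose B := [set w | L < sqmean C n w].
have mB : measurable B.
  by rewrite -[B]setTI; apply: measurable_fun_ltr.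
suff PB : (P B <= ((\int[P]_w (C (X w) ^+ 2)) / L)%:E)%E.
  have := holds_outside_measurable mB PB; apply: holds_outsideS => // w.
  by move=> /negP; rewrite -leNgt.
have Esq : (\int[P]_w (sqmean C n w)%:E)%E = (\int[P]_w (C (X w) ^+ 2))%:E.
  rewrite -integral_fineK; last by apply: integrable_sqr => //; exact: measurable_compRV.
  under eq_integral do rewrite /sqmean EFinM -sumEFin.
  rewrite ge0_integralZl_EFin ?invr_ge0//; last 2 first.
  - by move=> w _; apply: sume_ge0 => i _; rewrite lee_fin sqr_ge0.
  - by apply: emeasurable_sum => i; exact/measurable_EFinP.
  rewrite ge0_integral_sum//; last 2 first.
  - by move=> i; exact/measurable_EFinP.
  - by move=> i w _; rewrite lee_fin sqr_ge0.
  rewrite (eq_bigr (fun=> (\int[P]_w (C (X w) ^+ 2)%:E)%E)) => [|i _]; last first.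
    apply: (same_distribution_integral (f := fun x => C x ^+ 2) (same i)).
      exact: measurable_funX.
    by move=> x; exact: sqr_ge0.
  rewrite integral_fineK; last by apply: integrable_sqr => //; exact: measurable_compRV.
  rewrite sumEFin -EFinM; congr (_%:E); rewrite sumr_const card_ord -[X in _ * X]mulr_natl.
  by rewrite mulKf// pnatr_eq0 -lt0n.
rewrite -[B]setIT -integral_indic//.
apply: (@le_trans _ _ (\int[P]_w (L^-1%:E * (sqmean C n w)%:E))%E).
  apply: ge0_le_integral => //.
  - by apply/measurable_EFinP; exact: measurable_indic.
  - by apply/measurable_EFinP; exact: measurable_funM.
  move=> w _; rewrite -EFinM lee_fin indicE; case: (boolP (w \in B)) => [|_]; last first.
    by rewrite mulr_ge0// invr_ge0 ltW.
  by rewrite inE /B /= mulrC => /ltW Lw; rewrite ler_pdivlMr// mul1r.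
rewrite ge0_integralZl_EFin ?invr_ge0 ?(ltW L0)//.
- by rewrite Esq -EFinM mulrC.
- by move=> w _; rewrite lee_fin.
- exact/measurable_EFinP.
Qed.

Section LipschitzLoss.
Context {q : nat}.
Variables (T0 : set 'rV[R]_q) (f : T -> 'rV[R]_q -> R) (C : T -> R) (th0 : 'rV[R]_q).
Hypotheses (mf : forall th, T0 th -> measurable_fun setT (f^~ th))
  (fi : forall th, T0 th -> P.-integrable setT (EFin \o (fun w => f (X w) th)))
  (mC : measurable_fun setT C) (C0 : forall x, 0 <= C x) (finC : finite_second_moment P (fun w => C (X w)))
  (lipC : forall p p', T0 p -> T0 p' ->
     \forall x \ae distribution P X, `|f x p - f x p'| <= C x * `|p - p'|)
  (lipf : \forall x \ae distribution P X, lipschitz_bounded T0 (f x))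
  (T0th0 : T0 th0).
Let r th := \int[P]_w f (X w) th.
Hypothesis (lipr : lipschitz_bounded T0 r).

Definition excess (n : nat) (th : 'rV[R]_q) (w : Omega) : R :=
  \sum_(i < n) (f (X_ i w) th - f (X_ i w) th0) - n%:R * (r th - r th0).

Lemma excessB n p p' w : excess n p w - excess n p' w =
  \sum_(i < n) (f (X_ i w) p - f (X_ i w) p') - n%:R * (r p - r p').
Proof. rewrite /excess !sumrB; ring. Qed.

Lemma excess_lipschitz n :
  \forall w \ae P, lipschitz_bounded T0 (excess n ^~ w).
Proof.
apply: filterS (sample_ae lipf) => w /choice[Li hL].
have [Lr hr] := lipr.
exists (\sum_(i < n) Li i + n%:R * Lr) => p p' Tp Tp'.
rewrite excessB mulrDl; apply: le_trans (ler_normB _ _) _; apply: lerD.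
  rewrite mulr_suml; apply: le_trans (ler_norm_sum _ _ _) _.
  by apply: ler_sum => i _; exact: hL.
by rewrite normrM ger0_norm ?ler0n// -mulrA ler_wpM2l ?ler0n// hr.
Qed.

(** Chaining on the ball of radius [rho]. All links at depth [s] are controlled
    simultaneously by [sum_deviation] with [rho / 2 ^+ s] instead of [rho]. *)
Lemma chaining_deviation (n : nat) (rho t : R) : (0 < n)%N -> 0 < rho -> 0 <= t ->
  holds_outside P (expR (- t)) (fun w => forall th, T0 th -> `|th - th0| <= rho ->
    - (rho * Num.sqrt n%:R *
       (2 * (t + sqmean C n w + \int[P]_w (C (X w) ^+ 2)) + 6 * (4 * q + 1)%:R))
    <= excess n th w).
Proof.
move=> n0 rho0 t0.
set sig := \int[P]_w (C (X w) ^+ 2).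
pose T' : set 'rV[R]_q := [set th | T0 th /\ `|th - th0| <= rho].
have T'0 : T' th0 by split=> //; rewrite subrr normr0 ltW.
have /choice[F hF] : forall s, exists F : seq 'rV[R]_q,
    [/\ forall p, p \in F -> T' p,
        forall th, T' th -> exists2 p, p \in F & `|th - p| <= rho / 2 ^+ s,
        (size F <= 4 ^ (s.+1 * q))%N & s = 0%N -> F = [:: th0]].
  (* At depth 0, the centre alone is a net, and the process vanishes there. *)
  case=> [|s].
    exists [:: th0]; split => //.
    - by move=> p; rewrite inE => /eqP ->.
    - by move=> th [_ h]; exists th0; rewrite ?inE// expr0 divr1.
    - by rewrite expn_gt0.
  have [F [F1 F2 F3]] := @finite_net R q T' th0 rho s.+1 rho0 (fun th => @proj2 _ _).
  by exists F; split.
pose v s := t + (4 * q + 1)%:R * (s + 2)%:R.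
pose a s w := rho / 2 ^+ s * Num.sqrt n%:R * (v s + sqmean C n w + sig).
have link s : holds_outside P (expR (- t) / (2 ^ s.+1)%:R) (fun w =>
    forall pp, pp \in [seq (p, p') | p <- F s.+1, p' <- F s] ->
      `|pp.1 - pp.2| <= rho / 2 ^+ s -> excess n pp.2 w - a s w <= excess n pp.1 w).
  have h0 : 0 <= expR (- v s) by exact: expR_ge0.
  have := @holds_outside_forall_seq _ _ _ P _
    [seq (p, p') | p <- F s.+1, p' <- F s] (expR (- v s))
    (fun pp w => `|pp.1 - pp.2| <= rho / 2 ^+ s -> excess n pp.2 w - a s w <= excess n pp.1 w).
  move=> h; apply: holds_outsideS (h _) => [|//|].
    apply: le_trans (link_count_bound q s t); apply: ler_wpM2r => //.
    rewrite ler_nat size_allpairs leq_mul//.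
      by case: (hF s.+1).
    by case: (hF s).
  move=> _ /allpairsP[[p p'] /= [pF p'F ->]] /=.
  case: (leP `|p - p'| (rho / 2 ^+ s)) => pp'; last first.
    by apply: (holds_outsideS h0 _ (holds_outside_ae (aeW P (fun=> I)))).
  have [T0p _] : T' p by case: (hF s.+1) => h1 _ _ _; exact: h1.
  have [T0p' _] : T' p' by case: (hF s) => h1 _ _ _; exact: h1.
  have rs0 : 0 < rho / 2 ^+ s by rewrite divr_gt0// exprn_gt0.
  have := @sum_deviation (fun x => f x p' - f x p) C (rho / 2 ^+ s) (v s) n
    (measurable_funB (mf T0p') (mf T0p)) mC finC rs0 n0.
  have ZC : \forall x \ae distribution P X, `|f x p' - f x p| <= rho / 2 ^+ s * C x.
    apply: filterS (lipC T0p T0p') => x h1.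
    by rewrite distrC (le_trans h1)// mulrC ler_wpM2r.
  move=> /(_ ZC); apply: holds_outsideS => // w.
  rewrite RintegralB ?fi// -/(r p') -/(r p) -/sig -/(a s w) -excessB => h1 _.
  by lra.
have := holds_outsideI (holds_outside_forall_nat (expR_ge0 (- t)) link)
   (holds_outside_ae (excess_lipschitz n)).
apply: holds_outsideS; first by rewrite addr0.
move=> w [hlink [L hL]] th Tth thrho.
apply: (@chain_lower_bound _ (excess n ^~ w) T' F (fun s => rho / 2 ^+ s) (a ^~ w) _).
- by move=> s p; case: (hF s) => h _ _ _; exact: h.
- by move=> s p; case: (hF s) => _ h _ _; exact: h.
- case: (hF 0%N) => _ _ _ -> // g; rewrite inE => /eqP ->.
  by rewrite /excess sumrB !subrr mulr0 subr0.
- move=> s p p' pF p'F; apply: (hlink s (p, p')).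
  exact: allpairs_f.
- move=> S.
  have Q0 : 0 <= sqmean C n w.
    by rewrite mulr_ge0 ?invr_ge0// sumr_ge0// => i _; exact: sqr_ge0.
  have sig0 : 0 <= sig by apply: Rintegral_ge0 => w' _; exact: sqr_ge0.
  have := @sum_halving_le (4 * q + 1)%:R (t + sqmean C n w + sig) S (ler0n _ _)
    (addr_ge0 (addr_ge0 t0 Q0) sig0).
  move=> /(ler_wpM2l (mulr_ge0 (ltW rho0) (sqrtr_ge0 n%:R))).
  apply: le_trans; rewrite mulr_sumr le_eqVlt; apply/orP; left; apply/eqP.
  by apply: eq_bigr => s _; rewrite /a /v; ring.
- by exists L => p p' [Tp _] [Tp' _]; exact: hL.
- under eq_fun do rewrite -exprVn.
  by apply: cvg_geometric; rewrite ger0_norm; lra.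
- by split.
Qed.

Hypotheses (c : R) (c0 : 0 < c)
  (growth : forall th, T0 th -> r th0 + c * `|th - th0| ^+ 2 <= r th).

(** Peeling. The shell [2 ^+ i.-1 < sqrt n * `|th - th0| <= 2 ^+ i] is treated
    with confidence level [t + i.+1], summable over [i]. There the process
    deviates by at most [2 ^+ i * (b + 2 i)], whereas [n] times the risk has grown
    by at least [c / 4 * (2 ^+ i) ^+ 2]. *)
Lemma uniform_lower_bound (eps : R) : 0 < eps -> exists K, forall n, (0 < n)%N ->
  holds_outside P eps (fun w => forall th, T0 th ->
    - K <= \sum_(i < n) (f (X_ i w) th - f (X_ i w) th0)).
Proof.
move=> eps0; set sig := \int[P]_w (C (X w) ^+ 2).
have sig0 : 0 <= sig by apply: Rintegral_ge0 => w' _; exact: sqr_ge0.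
have e20 : 0 < eps / 2 by rewrite divr_gt0.
pose t := (eps / 2)^-1; have t0 : 0 < t by rewrite invr_gt0.
pose L := 2 * (sig + 1) / eps; have L0 : 0 < L by rewrite divr_gt0//; lra.
pose b := 2 * (t + 1 + L + sig) + 6 * (4 * q + 1)%:R.
have b0 : 0 <= b by rewrite /b addr_ge0// mulr_ge0//; lra.
have c40 : 0 < c / 4 by rewrite divr_gt0.
have [K0 K00 hK0] := pow2_dominates c40 b0.
exists (K0 + c / 4) => n n0.
pose sn : R := Num.sqrt n%:R.
have sn0 : 0 < sn by rewrite sqrtr_gt0 ltr0n.
have sn2 : sn ^+ 2 = n%:R by rewrite sqr_sqrtr// ler0n.
have shell i : holds_outside P (eps / 2 / (2 ^ i.+1)%:R)
    (fun w => forall th, T0 th -> `|th - th0| <= 2 ^+ i / sn ->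
      - (2 ^+ i / sn * sn * (2 * (t + i.+1%:R + sqmean C n w + sig) + 6 * (4 * q + 1)%:R))
      <= excess n th w).
  have rho0 : 0 < 2 ^+ i / sn by rewrite divr_gt0// exprn_gt0.
  have ti0 : 0 <= t + i.+1%:R by rewrite addr_ge0// ltW.
  have := chaining_deviation n0 rho0 ti0; apply: holds_outsideS => //.
  rewrite opprD expRD; apply: ler_pM; rewrite ?expR_ge0 ?expRN_inv_le//.
  by rewrite expRN lef_pV2 ?posrE ?expR_gt0 ?ltr0n ?expn_gt0// exp2_le_expR.
have := holds_outsideI (holds_outside_forall_nat (ltW e20) shell) (sqmean_tight n0 mC finC L0).
rewrite -/sig; apply: holds_outsideS.
  have : sig / L <= eps / 2; last lra.
  have eL : eps / 2 * L = sig + 1 by rewrite /L; field; rewrite gt_eqF.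
  by rewrite ler_pdivrMr// eL lerDl.
move=> w [hshell hL] th Tth.
have ex : exists i, `|th - th0| <= 2 ^+ i / sn.
  exists (Num.truncn (`|th - th0| * sn)).+1; rewrite ler_pdivlMr//.
  apply: (@le_trans _ _ (Num.truncn (`|th - th0| * sn)).+1%:R).
    exact/ltW/truncnS_gt.
  by rewrite -natrX ler_nat ltnW// ltn_expl.
(* The least i whose ball contains th; its minimality gives the lower bound hlow
   on the distance. *)
have [i hi imin] : exists2 i, `|th - th0| <= 2 ^+ i / sn &
    forall j, `|th - th0| <= 2 ^+ j / sn -> (i <= j)%N.
  by case: (ex_minnP ex) => i; exists i.
have := hshell i th Tth hi; rewrite divfK ?gt_eqF// => hex.
have := growth Tth => /(ler_wpM2l (ler0n R n)) hg.
clearbody sig t L sn.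
have hb : 2 * (t + i.+1%:R + sqmean C n w + sig) + 6 * (4 * q + 1)%:R <= b + 2 * i%:R.
  by rewrite /b -[i.+1%:R]natr1; move: (6 * _) => k; lra.
clearbody b.
have x0 : 0 < 2 ^+ i :> R by rewrite exprn_gt0.
have hxb := ler_wpM2l (ltW x0) hb.
have hS : n%:R * (c * `|th - th0| ^+ 2) - 2 ^+ i * (b + 2 * i%:R) <=
    \sum_(i < n) (f (X_ i w) th - f (X_ i w) th0).
  by move: hex; rewrite /excess; lra.
apply: le_trans hS; have := hK0 i.
suff : c / 4 * (2 ^+ i) ^+ 2 - c / 4 <= n%:R * (c * `|th - th0| ^+ 2) by lra.
have d0 := normr_ge0 (th - th0).
(* In the innermost ball, no growth is available: this costs the extra c / 4. *)
case: (posnP i) => [->|ipos].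
  by rewrite expr0 expr1n mulr1 subrr !mulr_ge0// ?sqr_ge0// ltW.
have hlow : 2 ^+ i / 2 <= `|th - th0| * sn.
  rewrite leNgt; apply/negP => hlt.
  have : (i <= i.-1)%N.
    apply: imin; rewrite ler_pdivlMr// ltW//; apply: lt_le_trans hlt _.
    by rewrite -[in leLHS](prednK ipos) exprS; lra.
  by rewrite leqNgt ltn_predL ipos.
have : (2 ^+ i / 2) ^+ 2 <= (`|th - th0| * sn) ^+ 2.
  by rewrite lerXn2r ?nnegrE ?mulr_ge0// ?divr_ge0// ltW.
rewrite [leRHS]exprMn sn2 expr_div_n => /(ler_wpM2l (ltW c0)) h4.
have c4 : c / 4 * (2 ^+ i) ^+ 2 = c * ((2 ^+ i) ^+ 2 / 2 ^+ 2) by field.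
have nc : n%:R * (c * `|th - th0| ^+ 2) = c * (`|th - th0| ^+ 2 * n%:R) by ring.
by rewrite c4 nc lerBlDr (le_trans h4)// lerDl ltW.
Qed.

End LipschitzLoss.
End EmpiricalProcess.

(** * Minima of Lipschitz functions on compact sets *)

Section LipschitzOnCompact.
Context {R : realType} {q : nat}.
Implicit Types (A : set 'rV[R]_q) (f : 'rV[R]_q -> R).

Lemma lipschitz_boundedP A f : [lipschitz f x | x in A] -> lipschitz_bounded A f.
Proof.
move=> [M [_ hM]]; exists (M + 1) => p p' Ap Ap'.
by have := hM (M + 1); rewrite ltrDl ltr01 => /(_ isT) /(_ (p, p') (conj Ap Ap')).
Qed.

Lemma lipschitz_bounded_continuous A f : lipschitz_bounded A f -> {within A, continuous f}.
Proof.
move=> [L hL]; apply/subspace_continuousP => x Ax.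
apply/cvgrPdist_lt => e e0.
have L1 : 0 < `|L| + 1 by rewrite ltr_wpDl.
near=> y.
have Ay : A y by near: y; exact: withinT.
apply: le_lt_trans (hL _ _ Ax Ay) _.
apply: (@le_lt_trans _ _ ((`|L| + 1) * `|x - y|)).
  by apply: ler_wpM2r => //; apply: le_trans (ler_norm _) _; rewrite lerDl.
rewrite mulrC -ltr_pdivlMr//.
near: y; apply: cvg_within.
have /cvgrPdist_lt h : (y @[y --> x]) --> x by exact: cvg_id.
exact: (h _ (divr_gt0 e0 L1)).
Unshelve. all: by end_near. Qed.

Lemma lipschitz_attains_min A f : compact A -> A !=set0 -> lipschitz_bounded A f ->
  exists2 x, A x & forall y, A y -> f x <= f y.
Proof.
move=> cA A0 /lipschitz_bounded_continuous cf.
have [x xA hx] := EVT_min_rV A0 cA cf.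
by exists x; [exact: set_mem|move=> y Ay; apply: hx; exact: mem_set].
Qed.

Lemma minimumE (S : set R) x : S x -> lbound S x -> minimum S = x.
Proof.
move=> Sx lx; rewrite /minimum; case: xgetP => [y _ [Sy ly]|/(_ x)].
  by apply/eqP; rewrite eq_le ly// lx.
by case.
Qed.

Lemma enorm_le_norm (v : 'rV[R]_q) : enorm v <= q%:R * `|v|.
Proof.
have qv0 : 0 <= q%:R * `|v| by rewrite mulr_ge0.
rewrite -[leRHS]ger0_norm// -sqrtr_sqr ler_wsqrtr//.
apply: (@le_trans _ _ (\sum_(i < q) `|v| ^+ 2)).
  apply: ler_sum => i _; rewrite -[v ord0 i ^+ 2]real_normK ?num_real//.
  by rewrite lerXn2r ?nnegrE// rV_le_norm.
rewrite sumr_const card_ord exprMn -[_ *+ q]mulr_natl ler_wpM2r ?sqr_ge0//.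
by rewrite -natrX ler_nat; case: (q) => // k; rewrite expnS leq_pmulr// expn1.
Qed.

Lemma norm_le_enorm (v : 'rV[R]_q) : `|v| <= enorm v.
Proof.
apply: rV_norm_le => [|i]; first exact: sqrtr_ge0.
rewrite -sqrtr_sqr ler_wsqrtr// (bigD1 i)//= lerDl sumr_ge0// => j _.
exact: sqr_ge0.
Qed.

Lemma compact_dist_bounded A x0 : compact A ->
  exists2 D, 0 < D & forall y, A y -> `|y - x0| <= D.
Proof.
move=> /compact_bounded[M [_ hM]].
exists (`|M| + 1 + `|x0|); first by rewrite ltr_pwDl// ltr_wpDl.
move=> y Ay; apply: le_trans (ler_normB _ _) _; rewrite lerD2r.
by apply: hM => //; apply: le_lt_trans (ler_norm _) _; rewrite ltrDl.
Qed.

(** Away from [x0], compactness bounds the excess of [f] from below by a positive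
    constant, and the square of the distance from above. *)
Lemma quadratic_growth_compact A f x0 : compact A -> lipschitz_bounded A f ->
  unique_minimiser A f x0 -> quadratic_growth A f x0 ->
  exists2 c, 0 < c & forall y, A y -> f x0 + c * `|y - x0| ^+ 2 <= f y.
Proof.
move=> cA lipA [Ax0 umin] [C C0 /nbhs_ballP[e /= e0 near]].
pose A' := A `&` ~` ball x0 e.
have cA' : compact A'.
  by apply: compact_closedI => //; apply: open_closedC; exact: ball_open.
have inner y : A y -> ball x0 e y -> f x0 + C * `|y - x0| ^+ 2 <= f y.
  move=> Ay by0; apply: le_trans (near _ by0 Ay); rewrite lerD2l (ler_wpM2l (ltW C0))//.
  by rewrite lerXn2r ?nnegrE ?sqrtr_ge0// norm_le_enorm.
have [A'0|A'N] := pselect (A' !=set0); last first.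
  exists C => // y Ay; apply: inner => //; apply: contrapT => nb.
  by apply: A'N; exists y.
have [L hL] := lipA.
have lipA' : lipschitz_bounded A' f.
  by exists L => p p' [Ap _] [Ap' _]; exact: hL.
have [z [Az nbz] zmin] := lipschitz_attains_min cA' A'0 lipA'.
have fz : f x0 < f z.
  apply: umin => // zx; apply: nbz; rewrite zx; exact: ballxx.
have [D D0 hD] := compact_dist_bounded x0 cA.
pose m := (f z - f x0) / D ^+ 2.
have m0 : 0 < m by rewrite divr_gt0 ?subr_gt0// exprn_gt0.
exists (Num.min C m); first by rewrite lt_min C0 m0.
move=> y Ay; have y2 : 0 <= `|y - x0| ^+ 2 by exact: sqr_ge0.
have [by0|nby] := pselect (ball x0 e y).
  by apply: le_trans (inner y Ay by0); rewrite lerD2l ler_wpM2r// ge_min lexx.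
apply: le_trans (zmin y (conj Ay nby)).
rewrite -lerBrDl; apply: (@le_trans _ _ (m * `|y - x0| ^+ 2)).
  by rewrite ler_wpM2r// ge_min lexx orbT.
rewrite /m mulrAC ler_pdivrMr ?exprn_gt0// ler_wpM2l ?subr_ge0 ?(ltW fz)//.
by rewrite lerXn2r ?nnegrE ?(ltW D0) ?hD.
Qed.

(** The nets of all depths, enumerated through a pairing of the integers. *)
Lemma compact_dense_sequence A x0 : compact A -> A x0 ->
  exists d : nat -> 'rV[R]_q, (forall j, A (d j)) /\
    (forall p, A p -> forall e, 0 < e -> exists j, `|p - d j| <= e).
Proof.
move=> cA Ax0.
have [D D0 hD] := compact_dist_bounded x0 cA.
have /choice[F hF] := fun s => finite_net s D0 hD.
pose d j := if unpickle j is Some si then nth x0 (F si.1) si.2 else x0.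
exists (fun j => d j); split.
  move=> j; rewrite /d; case: (unpickle j) => // -[s i] /=.
  case: (ltnP i (size (F s))) => [iF|Fi]; last by rewrite nth_default.
  by case: (hF s) => h _ _; apply: h; exact: mem_nth.
move=> p Ap e e0.
have : \forall s \near \oo, `|D / 2 ^+ s| < e.
  have /cvgr0Pnorm_lt h : (fun s => D / 2 ^+ s) @ \oo --> (0 : R).
    under eq_fun do rewrite -exprVn.
    by apply: cvg_geometric; rewrite ger0_norm; lra.
  exact: h.
case=> s _ /(_ s (leqnn s)) /ltW hs.
case: (hF s) => _ /(_ p Ap)[y yF py] _.
exists (pickle (s, index y (F s))); rewrite /d pickleK /= nth_index//.
by rewrite (le_trans py)// (le_trans (ler_norm _)).
Qed.

End LipschitzOnCompact.

(** * The smallest minimiser over a finite set of indices *)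

Section MinArgmin.
Context {R : realType} {m : nat}.
Implicit Types (f : 'I_m.+1 -> R).

Lemma min_argminP f : argmin f (min_argmin f) /\
  forall j, argmin f j -> (min_argmin f <= j)%N.
Proof.
have [k kmin] : exists k, argmin f k.
  exists [arg min_(i < ord0) f i]%O; case: Order.TotalTheory.arg_minP => // i _ h j.
  exact: h.
have [i imin ilow] : exists2 i, argmin f i & forall j, argmin f j -> (i <= j)%N.
  have kmin' : `[< argmin f k >] by exact/asboolP.
  exists [arg min_(i < k | `[< argmin f i >]) (i : nat)];
    case: arg_minnP => // i /asboolP hi h //.
  by move=> j hj; apply: h; exact/asboolP.
by rewrite /min_argmin; case: xgetP => [j _ []|/(_ i)] // []; split.
Qed.

Lemma min_argmin_eqP f k : min_argmin f = k <->
  (forall j, f k <= f j) /\ (forall j : 'I_m.+1, (j < k)%N -> f k < f j).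
Proof.
have [h1 h2] := min_argminP f; split=> [<-|[k1 k2]].
  split=> // j jk; rewrite ltNge; apply/negP => fj.
  have /h2 : argmin f j by move=> i; rewrite (le_trans fj).
  by rewrite leqNgt jk.
apply/val_inj/eqP; rewrite eqn_leq h2//= leqNgt; apply/negP => lt.
by have := k2 _ lt; rewrite ltNge h1.
Qed.

End MinArgmin.

(** * Asymptotic statements in probability *)

Section Asymptotics.
Context {R : realType} {dO : measure_display} {Omega : measurableType dO}.
Variable P : probability Omega R.

Definition asymptotically (Q : nat -> Omega -> Prop) : Prop :=
  forall e : R, 0 < e -> \forall n \near \oo, holds_outside P e (Q n).

Lemma asymptotically_forall (m : nat) (Q : 'I_m.+1 -> nat -> Omega -> Prop) :
  (forall l, asymptotically (Q l)) -> asymptotically (fun n w => forall l, Q l n w).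
Proof.
move=> hQ e e0.
have em : 0 < e / m.+1%:R by rewrite divr_gt0.
have : \forall n \near \oo, forall l, holds_outside P (e / m.+1%:R) (Q l n).
  by apply: filter_forall => l; exact: hQ.
apply: filterS => n h.
have := @holds_outside_forall_seq _ _ _ P _ (enum 'I_m.+1) _ (fun l => Q l n) (fun l _ => h l).
apply: holds_outsideS => [|w hw l]; last by apply: hw; rewrite mem_enum.
by rewrite size_enum_ord mulrC divfK.
Qed.

Lemma probability_cvg1 (E : nat -> set Omega) : (forall n, measurable (E n)) ->
  asymptotically (fun n w => E n w) -> P (E n) @[n --> \oo] --> 1%E.
Proof.
move=> mE hE.
have PE n : P (E n) = (fine (P (E n)))%:E by rewrite fineK// fin_num_measure.
under eq_fun do rewrite PE.
apply: cvg_EFin; first exact: nearW.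
apply/cvgrPdist_le => e e0; apply: filterS (hE e e0) => n [B [mB PB [N [mN N0 NB]]]].
have le1 : fine (P (E n)) <= 1 by rewrite -lee_fin -PE; exact: probability_le1.
rewrite ger0_norm ?subr_ge0//.
have : (P (~` E n) <= e%:E)%E.
  apply: (@le_trans _ _ (P (B `|` N))).
    apply: le_measure; rewrite ?inE//.
    - exact: measurableC.
    - exact: measurableU.
    move=> w nE; apply: contrapT => /not_orP[nB nN]; apply: nN; apply: NB => /=.
    by move/(_ nB).
  rewrite (le_trans (measureU2 _ mB mN))//.
  rewrite -[leRHS]adde0; apply: leeD => //.
  by rewrite le_eqVlt; apply/orP; left; apply/eqP; exact: N0.
by rewrite probability_setC// PE -EFinB lee_fin.
Qed.

Lemma cvg0_holds_outside (S : nat -> set Omega) (e : R) : 0 < e ->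
  (forall n, measurable (S n)) -> P (S n) @[n --> \oo] --> 0%E ->
  \forall n \near \oo, holds_outside P e (fun w => ~ S n w).
Proof.
move=> e0 mS /fine_cvg /cvgrPdist_le /(_ e e0); apply: filterS => n.
rewrite /= sub0r normrN => h; apply: holds_outside_measurable => //.
have -> : P (S n) = (fine (P (S n)))%:E by rewrite fineK// fin_num_measure.
by rewrite lee_fin (le_trans (ler_norm _)).
Qed.

Lemma diverges_holds_outside (Z : nat -> Omega -> R) (M e : R) : 0 < e ->
  (forall n, measurable_fun setT (Z n)) -> diverges_in_prob P Z ->
  \forall n \near \oo, holds_outside P e (fun w => M < Z n w).
Proof.
move=> e0 mZ dZ; pose M' := `|M| + 1; have M'0 : 0 < M' by rewrite ltr_wpDl.
pose S n := [set w | M' < Z n w].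
have mS n : measurable (S n) by rewrite -[S n]setTI; exact: measurable_fun_ltr.
have : P (~` S n) @[n --> \oo] --> 0%E.
  under eq_fun do rewrite probability_setC//.
  rewrite -(@subee _ 1%E)//; apply: cvgeB => //; [exact: cvg_cst|exact: dZ].
move=> /(cvg0_holds_outside e0 (fun n => measurableC (mS n))).
apply: filterS => n; apply: holds_outsideS => // w /contrapT.
by rewrite /S /= /M'; apply: le_lt_trans; rewrite (le_trans (ler_norm _))// lerDl.
Qed.

Lemma cvg_in_prob_holds_outside (Z : nat -> Omega -> R) (c d e : R) : 0 < e -> 0 < d ->
  (forall n, measurable_fun setT (Z n)) -> cvg_in_prob P Z c ->
  \forall n \near \oo, holds_outside P e (fun w => `|Z n w - c| <= d).
Proof.
move=> e0 d0 mZ cZ.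
have mS n : measurable [set w | d < `|Z n w - c|].
  rewrite -[X in measurable X]setTI; apply: measurable_fun_ltr => //.
  by apply: measurableT_comp => //; exact: measurable_funB.
have := cvg0_holds_outside e0 mS (cZ d d0).
apply: filterS => n; apply: holds_outsideS => // w /negP.
by rewrite -leNgt.
Qed.

Lemma bounded_in_prob_holds_outside (Z : nat -> Omega -> R) (e : R) : 0 < e ->
  (forall n, measurable_fun setT (Z n)) -> bounded_in_prob P Z ->
  exists M, \forall n \near \oo, holds_outside P e (fun w => `|Z n w| <= M).
Proof.
move=> e0 mZ /(_ e e0)[M M0 hM]; exists M; apply: filterS hM => n PM.
have mS : measurable [set w | M < `|Z n w|].
  rewrite -[X in measurable X]setTI; apply: measurable_fun_ltr => //.
  exact: measurableT_comp.
have := holds_outside_measurable mS PM; apply: holds_outsideS => // w /negP.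
by rewrite -leNgt.
Qed.

End Asymptotics.

(** * Random variables with a finite second moment *)

Section SecondMoments.
Context {R : realType} {dO : measure_display} {Omega : measurableType dO}.
Variable P : probability Omega R.

Lemma finite_second_moment_norm (a : Omega -> R) : finite_second_moment P a ->
  finite_second_moment P (fun w => `|a w|).
Proof.
rewrite /finite_second_moment; congr ('E_P[_] < _)%E; apply: funext => w.
by rewrite real_normK ?num_real.
Qed.

Lemma finite_second_momentZ (k : R) (a : Omega -> R) : measurable_fun setT a ->
  finite_second_moment P a -> finite_second_moment P (fun w => k * a w).
Proof.
move=> ma fa.
have [] := @second_moment_le _ _ _ P (fun w => k * a w) (fun w => `|a w|) `|k| => //.
- exact: measurable_funM.
- exact: measurableT_comp.
- exact: finite_second_moment_norm.
- by apply: aeW => w; rewrite normrM.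
Qed.

Lemma finite_second_momentD (a b : Omega -> R) :
  measurable_fun setT a -> measurable_fun setT b ->
  finite_second_moment P a -> finite_second_moment P b ->
  finite_second_moment P (fun w => a w + b w).
Proof.
move=> ma mb fa fb.
have i2 := integrable_scaleR 2 (integrable_addR (integrable_sqr ma fa) (integrable_sqr mb fb)).
have mab : measurable_fun setT (fun w => (a w + b w) ^+ 2).
  by apply: measurable_funX; exact: measurable_funD.
have iab : P.-integrable setT (EFin \o (fun w => (a w + b w) ^+ 2)).
  apply: le_integrable i2 => //; first exact/measurable_EFinP.
  move=> w /=; rewrite lee_fin ger0_norm ?sqr_ge0// ger0_norm ?mulr_ge0 ?addr_ge0 ?sqr_ge0//.
  by have := sqr_ge0 (a w - b w); nra.
by rewrite /finite_second_moment unlock integral_fineK// ltry.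
Qed.

End SecondMoments.

(** * The empirical risk of one hypothesis *)

Section OneHypothesis.
Context {R : realType} {dO : measure_display} {Omega : measurableType dO}.
Variable P : probability Omega R.
Context {dT : measure_display} {T : measurableType dT}.
Variables (X : {RV P >-> T}) (X_ : nat -> {RV P >-> T}).
Hypotheses (indep : mutually_independent X_)
  (same : forall i, same_distribution (X_ i) X).
Context {q : nat}.
Variables (A : set 'rV[R]_q) (f : T -> 'rV[R]_q -> R) (th0 : 'rV[R]_q) (C : T -> R).
Hypotheses (cA : compact A)
  (mf : forall th, A th -> measurable_fun setT (f^~ th))
  (mC : measurable_fun setT C) (C0 : forall x, 0 <= C x)
  (finC : finite_second_moment P (fun w => C (X w)))
  (lipC : forall p p', A p -> A p' ->
     \forall x \ae distribution P X, `|f x p - f x p'| <= C x * enorm (p - p'))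
  (fin1 : exists2 tau, A tau & finite_second_moment P (fun w => f (X w) tau))
  (lipf : \forall x \ae distribution P X, lipschitz_bounded A (f x)).

Let r := risk P f X.
Let emp n th w := emp_risk f X_ n th w.

Lemma riskE th : r th = \int[P]_w f (X w) th.
Proof. by rewrite /r /risk unlock. Qed.

Lemma loss_second_moment th : A th -> finite_second_moment P (fun w => f (X w) th).
Proof.
move=> Ath; have [tau Atau ftau] := fin1.
have mfX th' : A th' -> measurable_fun setT (fun w => f (X w) th').
  by move=> h; exact: measurable_compRV (mf h).
have mCX := measurable_compRV X mC.
have mn : measurable_fun setT (fun w => `|f (X w) tau|).
  by apply: measurableT_comp => //; exact: mfX.
have mCe : measurable_fun setT (fun w => enorm (th - tau) * C (X w)).
  exact: measurable_funM.
have [] := @second_moment_le _ _ _ P (fun w => f (X w) th)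
   (fun w => `|f (X w) tau| + enorm (th - tau) * C (X w)) 1 => //.
- exact: mfX.
- exact: measurable_funD.
- apply: finite_second_momentD => //; first exact: finite_second_moment_norm.
  exact: finite_second_momentZ.
- have := @same_distribution_ae _ _ _ P _ _ X X _ (fun _ _ => erefl) (lipC Ath Atau).
  apply: filterS => w h; rewrite mul1r mulrC -lerBlDl.
  by apply: le_trans h; exact: lerB_dist.
Qed.

Lemma loss_integrable th : A th -> P.-integrable setT (EFin \o (fun w => f (X w) th)).
Proof.
move=> Ath; apply: integrable_sqrW; last exact: loss_second_moment.
exact: measurable_compRV (mf Ath).
Qed.

Lemma emp_riskE n th w : (0 < n)%N -> n%:R * emp n th w = \sum_(i < n) f (X_ i w) th.
Proof. by move=> n0; rewrite /emp /emp_risk mulrA mulfV ?mul1r// pnatr_eq0 -lt0n. Qed.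

(** The Euclidean Lipschitz bound becomes one for the sup norm, used by the nets,
    at the cost of the factor [q]. *)
Lemma emp_risk_lower_bound (eps : R) : 0 < eps -> lipschitz_bounded A r ->
  unique_minimiser A r th0 -> quadratic_growth A r th0 ->
  exists K, forall n, (0 < n)%N -> holds_outside P eps (fun w => forall th, A th ->
    n%:R * emp n th0 w - K <= n%:R * emp n th w).
Proof.
move=> eps0 lipr umin qg; have [Ath0 _] := umin.
have [c c0 growth] := quadratic_growth_compact cA lipr umin qg.
pose C' x := q%:R * C x.
have mC' : measurable_fun setT C' by exact: measurable_funM.
have C'0 x : 0 <= C' x by rewrite mulr_ge0.
have finC' : finite_second_moment P (fun w => C' (X w)).
  by apply: finite_second_momentZ => //; exact: measurable_compRV.
have lipC' p p' : A p -> A p' ->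
    \forall x \ae distribution P X, `|f x p - f x p'| <= C' x * `|p - p'|.
  move=> Ap Ap'; apply: filterS (lipC Ap Ap') => x h; apply: le_trans h _.
  rewrite /C' mulrAC [_ * C x]mulrC; apply: ler_wpM2l => //; exact: enorm_le_norm.
have rE : r = fun th => \int[P]_w f (X w) th by apply: funext => th; exact: riskE.
rewrite rE in lipr growth.
have [K hK] := uniform_lower_bound indep same mf loss_integrable mC' C'0 finC' lipC'
  lipf Ath0 lipr c0 growth eps0.
exists K => n n0; have := hK n n0; apply: holds_outsideS => // w h th Ath.
by have := h th Ath; rewrite !emp_riskE// sumrB; lra.
Qed.

(** [sum_deviation] for the loss and for its opposite, with the absolute value of
    the loss as envelope. *)
Lemma emp_risk_concentration (th : 'rV[R]_q) (eps : R) : A th -> 0 < eps ->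
  exists D, forall n, (0 < n)%N -> holds_outside P eps (fun w =>
    `|n%:R * emp n th w - n%:R * r th| <= Num.sqrt n%:R * D).
Proof.
move=> Ath eps0; pose F x := `|f x th|.
have mfth := mf Ath.
have mF : measurable_fun setT F by exact: measurableT_comp.
have finF : finite_second_moment P (fun w => F (X w)).
  exact: finite_second_moment_norm (loss_second_moment Ath).
set sig := \int[P]_w (F (X w) ^+ 2).
have sig0 : 0 <= sig by apply: Rintegral_ge0 => w _; exact: sqr_ge0.
pose e := eps / 3; have e0 : 0 < e by rewrite divr_gt0.
pose L := (sig + 1) / e; have L0 : 0 < L by rewrite divr_gt0// ltr_wpDl.
pose v := e^-1.
have ve : expR (- v) <= e by exact: expRN_inv_le.
exists (v + L + sig) => n n0.
have mN : measurable_fun setT (fun x => - f x th) by exact: measurable_funN.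
have b1 : \forall x \ae distribution P X, `|f x th| <= 1 * F x.
  by apply: aeW => x; rewrite mul1r.
have b2 : \forall x \ae distribution P X, `|- f x th| <= 1 * F x.
  by apply: aeW => x; rewrite mul1r normrN.
have h1 := sum_deviation indep same v mfth mF finF ltr01 n0 b1.
have h2 := sum_deviation indep same v mN mF finF ltr01 n0 b2.
have h3 := sqmean_tight same n0 mF finF L0.
have := holds_outsideI (holds_outsideI h1 h2) h3; apply: holds_outsideS.
  rewrite -/sig.
  have : sig / L <= e.
    have eL : e * L = sig + 1 by rewrite /L mulrC divfK// gt_eqF.
    by rewrite ler_pdivrMr// eL lerDl.
  have : eps = e + e + e by rewrite /e; field.
  lra.
move=> w [[]]; rewrite -/sig emp_riskE// riskE.
have -> : \int[P]_w (- f (X w) th) = - \int[P]_w f (X w) th.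
  have := RintegralZl (-1) measurableT (loss_integrable Ath).
  by under eq_Rintegral do rewrite mulN1r; rewrite mulN1r.
rewrite sumrN !mul1r => h4 h5 h6; rewrite ler_norml.
have h7 : Num.sqrt n%:R * (v + sqmean X_ F n w + sig) <= Num.sqrt n%:R * (v + L + sig).
  by rewrite ler_wpM2l ?sqrtr_ge0// lerD2r lerD2l.
by apply/andP; split; lra.
Qed.

Lemma measurable_emp_risk th n : A th -> measurable_fun setT (emp n th).
Proof.
move=> Ath; apply: measurable_funM => //; apply: measurable_sum => i.
exact: measurable_compRV (mf Ath).
Qed.

(** The infimum over a dense sequence is measurable everywhere, and is the minimum
    wherever the losses of the sample are Lipschitz. *)
Lemma measurable_min_emp_risk n : A !=set0 -> exists M : Omega -> R,
  measurable_fun setT M /\ \forall w \ae P,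
    [/\ minimum [set emp n th w | th in A] = M w,
        exists2 th, A th & M w = emp n th w &
        forall th, A th -> M w <= emp n th w].
Proof.
move=> [a Aa]; have [d [Ad dd]] := compact_dense_sequence cA Aa.
pose M w := fine (einfs (fun j => (emp n (d j) w)%:E) 0%N).
exists M; split.
  apply: measurableT_comp => //; apply: measurable_fun_einfs => j.
  by apply/measurable_EFinP; exact: measurable_emp_risk.
apply: filterS (sample_ae same lipf) => w /choice[Li hL].
have lipe : lipschitz_bounded A (emp n ^~ w).
  exists (n%:R^-1 * \sum_(i < n) Li i) => p p' Ap Ap'.
  rewrite /emp /emp_risk -mulrBr -sumrB normrM ger0_norm ?invr_ge0// -mulrA.
  rewrite ler_wpM2l ?invr_ge0// mulr_suml (le_trans (ler_norm_sum _ _ _))//.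
  by apply: ler_sum => i _; exact: hL.
have [x Ax xmin] := lipschitz_attains_min cA (ex_intro _ a Aa) lipe.
have Mx : M w = emp n x w.
  rewrite /M; suff -> : einfs (fun j => (emp n (d j) w)%:E) 0%N = (emp n x w)%:E by [].
  rewrite /einfs /=.
  apply/eqP; rewrite eq_le; apply/andP; split; last first.
    by apply: le_ereal_inf_tmp => _ [j _ <-]; rewrite lee_fin xmin.
  have [L hL'] := lipe; apply/lee_addgt0Pr => e e0.
  have L1 : 0 < `|L| + 1 by rewrite ltr_wpDl.
  have [j xj] := dd x Ax _ (divr_gt0 e0 L1).
  apply: (@le_trans _ _ (emp n (d j) w)%:E).
    by apply: ereal_inf_lbound; exists j.
  rewrite -EFinD lee_fin -lerBlDl.
  apply: le_trans (ler_norm _) _; apply: le_trans (hL' _ _ (Ad j) Ax) _.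
  rewrite distrC; apply: (@le_trans _ _ ((`|L| + 1) * `|x - d j|)).
    by rewrite ler_wpM2r// (le_trans (ler_norm _))// lerDl.
  by rewrite mulrC -ler_pdivlMr.
rewrite Mx; split.
- by apply: minimumE; [exists x|move=> _ [th Ath <-]; exact: xmin].
- by exists x.
- exact: xmin.
Qed.

End OneHypothesis.

(** * Consistency of the selected index *)

Theorem theorem2 (R : realType)
  (dO : measure_display) (Omega : measurableType dO) (P : probability Omega R)
  (d : nat) (XX : set 'rV[R]_d) (x0 : set_type XX)
  (X : {RV P >-> borel_type x0}) (X_ : nat -> {RV P >-> borel_type x0})
  (X_indep : mutually_independent X_)
  (X_same : forall i, same_distribution (X_ i) X)
  (m : nat) (q : 'I_m.+1 -> nat)
  (TT : forall k, set 'rV[R]_(q k))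
  (h : forall k, borel_type x0 -> 'rV[R]_(q k) -> R)
  (loss : R -> R)
  (lk := fun k x theta => loss (h k x theta))
  (lk_meas : forall k theta, TT k theta ->
     measurable_fun setT (fun x => lk k x theta))
  (r := fun k => risk P (lk k) X)
  (Rn := fun k n => emp_risk (lk k) X_ n)
  (kstar := opt_index P TT lk X)
  (Pen : 'I_m.+1 -> nat -> {RV P >-> R})
  (Pen_ge0 : forall k n w, (0 < n)%N -> 0 <= Pen k n w)
  (Khat := est_index TT lk X_ (fun k n => Pen k n))
  (thetas : forall k, 'rV[R]_(q k))
  (A1 : forall k, compact (TT k) /\
     exists2 tau, TT k tau & finite_second_moment P (fun w => lk k (X w) tau))
  (A2 : forall k, exists C : borel_type x0 -> R,
     [/\ measurable_fun setT C,
         forall x, 0 <= C x,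
         finite_second_moment P (fun w => C (X w)) &
         forall theta tau, TT k theta -> TT k tau ->
           \forall x \ae distribution P X,
             `|lk k x theta - lk k x tau| <= C x * enorm (theta - tau)])
  (B1 : forall k, (forall n w, (0 < n)%N -> 0 < Pen k n w) /\
     cvg_in_prob P (fun n => Pen k n) 0)
  (B2 : forall k l : 'I_m.+1, (k < l)%N ->
     diverges_in_prob P (fun n w => n%:R * (Pen l n w - Pen k n w)))
  (C1 : forall k, [/\ [lipschitz r k theta | theta in TT k],
     unique_minimiser (TT k) (r k) (thetas k) &
     twice_differentiable_on (TT k) (r k) (thetas k)])
  (C2 : forall k, \forall x \ae distribution P X,
     [lipschitz lk k x theta | theta in TT k] /\
     differentiable_on (TT k) (lk k x) (thetas k))
  (C3 : forall k, second_order_regular (TT k) (thetas k))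
  (C4 : forall k, quadratic_growth (TT k) (r k) (thetas k))
  (C5 : forall k, r k (thetas k) = r kstar (thetas kstar) ->
     bounded_in_prob P (fun n w =>
       n%:R * (Rn k n (thetas k) w - Rn kstar n (thetas kstar) w))) :
  (* Khat n is a random variable only up to a P-null set (on which the minima
     may fail to exist), so the event [Khat n = kstar] is an event of the
     completion of P: its probability is that of any measurable E n that
     coincides with it almost surely. *)
  exists E : nat -> set Omega,
    [/\ forall n, measurable (E n),
        forall n, \forall w \ae P, E n w <-> Khat n w = kstar &
        P (E n) @[n --> \oo] --> 1%E].
Proof.
have cTT k : compact (TT k) by case: (A1 k).
have fin1 k : exists2 tau, TT k tau & finite_second_moment P (fun w => lk k (X w) tau).
  by case: (A1 k).
have umin k : unique_minimiser (TT k) (r k) (thetas k) by case: (C1 k).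
have T0 k : TT k (thetas k) by case: (umin k).
have lipr k : lipschitz_bounded (TT k) (r k).
  by case: (C1 k) => /lipschitz_boundedP.
have lipf k : \forall x \ae distribution P X, lipschitz_bounded (TT k) (lk k x).
  by apply: filterS (C2 k) => x [/lipschitz_boundedP].
pose v k := r k (thetas k).
have minr k : minimum [set r k theta | theta in TT k] = v k.
  apply: minimumE; first by exists (thetas k).
  move=> _ [th Tth <-]; case: (umin k) => _ lt_min.
  by have [->//|/eqP/(lt_min th Tth)/ltW] := eqVneq th (thetas k).
have [kmin klow] : (forall j, v kstar <= v j) /\
    (forall j : 'I_m.+1, (j < kstar)%N -> v kstar < v j).
  have -> : v = fun k => minimum [set r k theta | theta in TT k].
    by apply: funext => k; rewrite minr.
  by apply/min_argmin_eqP.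
have lower k (eps : R) : 0 < eps -> exists K, forall n, (0 < n)%N ->
    holds_outside P eps (fun w => forall th, TT k th ->
      n%:R * Rn k n (thetas k) w - K <= n%:R * Rn k n th w).
  move=> eps0; have [C [mC C0 fC lC]] := A2 k.
  exact: (emp_risk_lower_bound X_indep X_same (cTT k) (@lk_meas k) mC C0 fC lC
    (fin1 k) (lipf k) eps0 (lipr k) (umin k) (C4 k)).
have conc k (eps : R) : 0 < eps -> exists D, forall n, (0 < n)%N ->
    holds_outside P eps (fun w =>
      `|n%:R * Rn k n (thetas k) w - n%:R * v k| <= Num.sqrt n%:R * D).
  move=> eps0; have [C [mC C0 fC lC]] := A2 k.
  exact: (emp_risk_concentration X_indep X_same (@lk_meas k) mC fC lC (fin1 k) (T0 k) eps0).
have mRn k n th : TT k th -> measurable_fun setT (Rn k n th).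
  by move=> Tth; exact: (measurable_emp_risk X_ (@lk_meas k)).
have /choice[M hM] : forall kn : 'I_m.+1 * nat, exists M : Omega -> R,
    measurable_fun setT M /\ \forall w \ae P,
    [/\ minimum [set Rn kn.1 kn.2 th w | th in TT kn.1] = M w,
        exists2 th, TT kn.1 th & M w = Rn kn.1 kn.2 th w &
        forall th, TT kn.1 th -> M w <= Rn kn.1 kn.2 th w].
  move=> [k n]; apply: (measurable_min_emp_risk X_same (cTT k) (@lk_meas k) (lipf k)).
  by exists (thetas k).
(* The penalised minima, with the minimum in its measurable version. *)
pose score k n w := M (k, n) w + Pen k n w.
have mscore k n : measurable_fun setT (score k n).
  by apply: measurable_funD => //; case: (hM (k, n)).
have aeM n : \forall w \ae P, forall k,
    [/\ minimum [set Rn k n th w | th in TT k] = M (k, n) w,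
        exists2 th, TT k th & M (k, n) w = Rn k n th w &
        forall th, TT k th -> M (k, n) w <= Rn k n th w].
  by apply: filter_forall => k; case: (hM (k, n)).
have mE n : measurable [set w | min_argmin (score ^~ n ^~ w) = kstar].
  have -> : [set w | min_argmin (score ^~ n ^~ w) = kstar] =
      (\bigcap_(j in [set: 'I_m.+1]) [set w | score kstar n w <= score j n w]) `&`
      (\bigcap_(j in [set j : 'I_m.+1 | (j < kstar)%N]) [set w | score kstar n w < score j n w]).
    apply/seteqP; split => w /=.
      by move/min_argmin_eqP => [h1 h2]; split => j jk; [exact: h1|exact: h2].
    by move=> [h1 h2]; apply/min_argmin_eqP; split => j; [exact: h1|exact: h2].
  apply: measurableI; apply: fin_bigcap_measurable => // j _.
    by rewrite -[X in measurable X]setTI; exact: measurable_fun_ler.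
  by rewrite -[X in measurable X]setTI; exact: measurable_fun_ltr.
exists (fun n => [set w | min_argmin (score ^~ n ^~ w) = kstar]); split => //.
- move=> n; apply: filterS (aeM n) => w hMw.
  suff -> : Khat n w = min_argmin (score ^~ n ^~ w) by [].
  rewrite /Khat /est_index; congr min_argmin; apply: funext => k.
  by rewrite /score; case: (hMw k) => <-.
apply: probability_cvg1 => //.
suff main l : l != kstar -> asymptotically P (fun n w => score kstar n w < score l n w).
  have : asymptotically P (fun n w => forall l, l != kstar -> score kstar n w < score l n w).
    apply: asymptotically_forall => l; case: (eqVneq l kstar) => [_|ne].
      move=> e e0; apply: nearW => n; apply: (holds_outsideS (ltW e0) (fun _ _ => _)).
        2: exact: holds_outside_ae (aeW P (fun=> I)).
      by move=> w _.
    by move=> e e0; apply: filterS (main l ne e e0) => n; apply: holds_outsideS.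
  move=> hall e e0; apply: filterS (hall e e0) => n; apply: holds_outsideS => // w hw.
  apply/min_argmin_eqP; split=> j.
    by have [->//|/hw/ltW] := eqVneq j kstar.
  move=> jk; apply: hw; apply: contraTneq jk => ->; by rewrite ltnn.
move=> lk_ne e e0.
(* At most four exceptional events are used below. *)
pose e' := e / 4; have e'0 : 0 < e' by rewrite divr_gt0.
have [K hK] := lower l e' e'0.
have reduce n w (A : R) : (0 < n)%N ->
    (forall k, [/\ minimum [set Rn k n th w | th in TT k] = M (k, n) w,
        exists2 th, TT k th & M (k, n) w = Rn k n th w &
        forall th, TT k th -> M (k, n) w <= Rn k n th w]) ->
    (forall th, TT l th -> n%:R * Rn l n (thetas l) w - K <= n%:R * Rn l n th w) ->
    n%:R * Rn kstar n (thetas kstar) w - n%:R * Rn l n (thetas l) w <= A ->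
    K + A < n%:R * (Pen l n w - Pen kstar n w) -> score kstar n w < score l n w.
  move=> n0 hMw hl hA hP.
  have n0' : 0 < n%:R :> R by rewrite ltr0n.
  have [_ [th Tth thE] _] := hMw l.
  have [_ _ /(_ _ (T0 kstar)) hk] := hMw kstar.
  rewrite -(ltr_pM2l n0') /score thE.
  have := hl th Tth; have := ler_wpM2l (ltW n0') hk.
  by rewrite !mulrDr; rewrite mulrBr in hP; lra.
have [vl|vl] := eqVneq (v l) (v kstar).
  (* Equal minimal risks: by minimality of kstar, l is larger, and pays a penalty
     gap of order more than 1 / n. *)
  have kl : (kstar < l)%N.
    rewrite ltn_neqAle eq_sym lk_ne leqNgt; apply/negP => /klow.
    by rewrite vl ltxx.
  have mdiff n : measurable_fun setT (fun w =>
      n%:R * (Rn l n (thetas l) w - Rn kstar n (thetas kstar) w)).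
    by apply: measurable_funM => //; apply: measurable_funB; exact: mRn.
  have [B hB] := bounded_in_prob_holds_outside e'0 mdiff (C5 l vl).
  have mpen n : measurable_fun setT (fun w => n%:R * (Pen l n w - Pen kstar n w)).
    by apply: measurable_funM => //; exact: measurable_funB.
  have hP := diverges_holds_outside (K + B) e'0 mpen (B2 _ _ kl).
  near=> n.
  have n0 : (0 < n)%N by near: n; exact: nbhs_infty_gt.
  have hBn : holds_outside P e' (fun w =>
     `|n%:R * (Rn l n (thetas l) w - Rn kstar n (thetas kstar) w)| <= B) by near: n.
  have hPn : holds_outside P e' (fun w => K + B < n%:R * (Pen l n w - Pen kstar n w)).
    by near: n.
  have := holds_outsideI (holds_outsideI (hK n n0) hBn)
    (holds_outsideI hPn (holds_outside_ae (aeM n))).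
  apply: holds_outsideS; first by rewrite /e'; lra.
  move=> w [[h1 h2] [h3 h4]]; apply: (reduce n w B) => //.
  by move: h2; rewrite ler_norml mulrBr => /andP[]; lra.
(* A positive gap g: the errors are of order 1 / sqrt n, and half of the gap
   absorbs the penalty of kstar. *)
have gap : 0 < v l - v kstar by rewrite subr_gt0 lt_neqAle eq_sym vl kmin.
set g := v l - v kstar in gap.
have [D1 hD1] := conc l e' e'0.
have [D2 hD2] := conc kstar e' e'0.
have g20 : 0 < g / 2 by rewrite divr_gt0.
have hP := cvg_in_prob_holds_outside e'0 g20 (fun n => measurable_funP (Pen kstar n)) (B1 kstar).2.
(* For n > S^2, half of the gap exceeds all error terms. *)
pose S := 2 * (`|K| + `|D1| + `|D2| + 1) / g.
near=> n.
have n0 : (0 < n)%N by near: n; exact: nbhs_infty_gt.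
have hPn : holds_outside P e' (fun w => `|Pen kstar n w - 0| <= g / 2) by near: n.
have nS : S ^+ 2 + 1 <= n%:R by near: n; exact: nbhs_infty_ger.
have := holds_outsideI (holds_outsideI (hK n n0) (hD1 n n0))
    (holds_outsideI (holds_outsideI (hD2 n n0) hPn) (holds_outside_ae (aeM n))).
apply: holds_outsideS; first by rewrite /e'; lra.
move=> w [[h1 h2] [[h3 h4] h5]].
set s := Num.sqrt n%:R in h2 h3.
have s0 : 0 <= s by exact: sqrtr_ge0.
have s2 : s * s = n%:R by rewrite -expr2 sqr_sqrtr// ler0n.
have d1 := ler_wpM2l s0 (ler_norm D1).
have d2 := ler_wpM2l s0 (ler_norm D2).
apply: (reduce n w (s * (`|D1| + `|D2|) - n%:R * g)) => //.
  by move: h2 h3; rewrite !ler_norml /g mulrBr mulrDr => /andP[h2 _] /andP[_ h3]; lra.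
clearbody g.
have S0 : 0 <= S by rewrite /S divr_ge0 ?(ltW gap)// mulr_ge0// !addr_ge0.
have Ss : S < s.
  by rewrite -(@ltr_pXn2r _ 2) ?nnegrE// [s ^+ 2]expr2 s2; apply: lt_le_trans nS; rewrite ltrDl.
have sg : s * (S * (g / 2)) < s * (s * (g / 2)).
  by rewrite ltr_pM2l ?ltr_pM2r// (le_lt_trans S0).
have Sg : S * (g / 2) = `|K| + `|D1| + `|D2| + 1 by rewrite /S; field; rewrite gt_eqF.
rewrite Sg mulrA s2 in sg.
have s1 : 1 <= s by rewrite -sqrtr1 ler_wsqrtr// (le_trans _ nS)// lerDr sqr_ge0.
have sK : `|K| <= s * `|K| by rewrite ler_peMl.
have pl : 0 <= n%:R * Pen l n w by rewrite mulr_ge0// Pen_ge0.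
have pk : n%:R * Pen kstar n w <= n%:R * (g / 2).
  by rewrite ler_wpM2l//; move: h4; rewrite subr0; apply: le_trans; exact: ler_norm.
have K0 := ler_norm K.
rewrite mulrBr; rewrite !mulrDr mulr1 in sg; rewrite mulrDr; lra.
Unshelve. all: by end_near. Qed.
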